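(* Let $(M,\mathcal D,\mathcal J)$ be a $k$-nondegenerate CR manifold with $\mathcal D_{-\mu}=TM$. For every $x\in M$, the $\mathbb Z$-graded vector space $\mathfrak m_x=\bigoplus_{p\in\mathbb Z}\mathfrak m_x^p$ defined by $$\mathfrak m_x^p=\frac{\mathcal D_p|_x}{\mathcal D_{p+1}|_x}\ \text{ for all } p\le-2,\qquad \mathfrak m_x^p=\frac{\operatorname{Re}(\mathcal F_p)|_x}{\operatorname{Re}(\mathcal F_{p+1})|_x}\ \text{ for all } p\ge-1,$$ has the natural structure of an abstract core of depth $\mu$ and height $k-2$.
   Context: **CR manifolds.** A CR structure on a manifold $M$ is a pair $(\mathcal D,\mathcal J)$, with $\mathcal D\subset TM$ an even rank distribution and $\mathcal J$ a smooth family of complex structures $\mathcal J_x:\mathcal D|_x\to\mathcal D|_x$ such that the $+i$-eigenbundle $\mathcal D^{10}\subset\mathcal D\otimes\mathbb C$ is involutive; $\mathcal D^{01}=\overline{\mathcal D^{10}}$. Underlining denotes spaces of sections. Tanaka sequence: $\underline{\mathcal D}_{-1}=\underline{\mathcal D}$, $\underline{\mathcal D}_{p}=\underline{\mathcal D}_{p+1}+[\underline{\mathcal D}_{-1},\underline{\mathcal D}_{p+1}]$ for $p\le-2$. Freeman sequence: $\underline{\mathcal F}_p=\underline{\mathcal F}_p^{10}\oplus\overline{\underline{\mathcal F}_p^{10}}$ for $p\ge-1$, where $\underline{\mathcal F}^{10}_{-1}=\underline{\mathcal D}^{10}$ and, for $p\ge0$, $\underline{\mathcal F}^{10}_{p}=\{X\in\underline{\mathcal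 F}^{10}_{p-1}:[X,\underline{\mathcal D}^{01}]=0\bmod\underline{\mathcal F}^{10}_{p-1}\oplus\underline{\mathcal D}^{01}\}$. All CR manifolds are assumed regular: these modules are the spaces of sections of distributions $\mathcal D_p\subset TM$ and $\mathcal F_p^{10}\subset\mathcal D^{10}$, and $\mathcal D_{-\mu}=TM$ for some positive integer $\mu$. $M$ is $k$-nondegenerate if $\mathcal F_p\ne0$ for all $-1\le p\le k-2$ and $\mathcal F_{k-1}=0$. **Abstract cores.** An abstract core is a finite-dimensional $\mathbb Z$-graded real vector space $\mathfrak m=\bigoplus\mathfrak m^p$ with (i) a grading-preserving complex structure $J$ on $\bigoplus_{p\ge-1}\mathfrak m^p$ (write $\widehat{\mathfrak m}^p=\mathfrak m^p\otimes\mathbb C=\mathfrak m^{p(10)}\oplus\mathfrak m^{p(01)}$ for the $\pm i$-eigenspaces); (ii) a bracket of $\mathbb Z$-graded Lie algebras on $\mathfrak m_-=\bigoplus_{p<0}\mathfrak m^p$ with $[Jv,Jw]=[v,w]$ for $v,w\in\mathfrak m^{-1}$, fundamental ($\mathfrak m_-$ is generated by $\mathfrak m^{-1}$) and nondegenerate ($v\in\mathfrak m^{-1}$, $[v,\mathfrak m^{-1}]=0$ imply $v=0$); (iii) for each $p\ge0$ an injective $\mathbb C$-linear map $L^{p+2}:\mathfrak m^{p(10)}\to\big(\mathfrak m^{p-1(10)}\otimes(\mathfrak m^{-1(01)})^*\big)\cap\big(\widehat{\mathfrak m}^{-2}\otimes S^{p+2}(\mathfrak m^{-1(01)})^*\big)$,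 where $\mathfrak m^{-1(10)}$ is understood as a space of maps $\mathfrak m^{-1(01)}\to\widehat{\mathfrak m}^{-2}$ via the bracket (ii). It has depth $\mu$ (resp. height $k-2$) if $\mathfrak m^p=0$ for all $p<-\mu$ (resp. all $p>k-2$). The natural structure on $\mathfrak m_x$ is: $J$ is induced by $\mathcal J$; the bracket on the negative part is induced by commutators of vector fields; for $p\ge0$, $L^{p+2}$ is induced by the higher order Levi form $\underline{\mathcal F}_p^{10}\times\underline{\mathcal D}^{01}\ni(X,Y)\mapsto[X,Y]\bmod\underline{\mathcal F}_p^{10}\oplus\underline{\mathcal D}^{01}$, with values in $(\mathcal F_{p-1}^{10}|_x\oplus\mathcal D^{01}|_x)/(\mathcal F_p^{10}|_x\oplus\mathcal D^{01}|_x)\simeq\mathfrak m_x^{p-1(10)}$.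
   Formalization: Regularity is strengthened: the fibre of F_{p+1}^{10} at each x must contain the pointwise kernel of the higher order Levi form on F_p^{10}; with section modules alone the lemma fails, e.g. for Im w = |z1|^2+|z2|^4 at z2 = 0. *)

(* Defs.v *)
From HB Require Import structures.
From mathcomp Require Import all_boot all_order all_algebra.
From mathcomp Require Import all_classical all_reals all_analysis.
From mathcomp Require Import complex.
Import numFieldNormedType.Exports.
Import Order.TTheory GRing.Theory Num.Theory.

Set Implicit Arguments.
Unset Strict Implicit.
Unset Printing Implicit Defensive.

Local Open Scope classical_set_scope.
Local Open Scope ring_scope.

(** [(u, v)] stands for [u + i v] in the complexification of [V]. *)

Definition cplx (V : Type) : Type := (V * V)%type.

HB.instance Definition _ (V : zmodType) := GRing.Zmodule.on (cplx V).

Section Complexification.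
Context (R : realType) (V : lmodType R).

Definition cplx_scale (a : R[i]) (z : cplx V) : cplx V :=
  (complex.Re a *: z.1 - complex.Im a *: z.2,
   complex.Re a *: z.2 + complex.Im a *: z.1).

Fact cplx_scaleA a b z : cplx_scale a (cplx_scale b z) = cplx_scale (a * b) z.
Proof.
case: a b z => [a1 a2] [b1 b2] [u v]; rewrite /cplx_scale /=.
rewrite !(scalerDr, scalerN, scalerA) !scalerDl !scaleNr.
congr pair; rewrite /= ?opprD.
  by rewrite [X in _ + X]addrC addrACA.
by rewrite [X in _ + X]addrC addrACA.
Qed.

Fact cplx_scale1 : left_id 1 cplx_scale.
Proof.
by case=> u v; rewrite /cplx_scale /= !scale1r !scale0r subr0 addr0.
Qed.

Fact cplx_scaleDr : right_distributive cplx_scale +%R.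
Proof.
case=> [a1 a2] [u v] [u' v']; rewrite /cplx_scale /=.
by congr pair; rewrite /= !scalerDr ?opprD addrACA.
Qed.

Fact cplx_scaleDl z : {morph cplx_scale^~ z : a b / a + b}.
Proof.
case: z => [u v] [a1 a2] [b1 b2]; rewrite /cplx_scale /=.
by congr pair; rewrite /= !scalerDl ?opprD addrACA.
Qed.

HB.instance Definition _ := GRing.Zmodule_isLmodule.Build R[i] (cplx V)
  cplx_scaleA cplx_scale1 cplx_scaleDr cplx_scaleDl.

End Complexification.

Definition cconj (V : zmodType) (z : cplx V) : cplx V := (z.1, - z.2).

Definition cmap (U V : Type) (f : U -> V) (z : cplx U) : cplx V :=
  (f z.1, f z.2).

Definition cbil (U V W : zmodType) (b : U -> V -> W)
    (z : cplx U) (w : cplx V) : cplx W :=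
  (b z.1 w.1 - b z.2 w.2, b z.1 w.2 + b z.2 w.1).

Definition setsum (V : zmodType) (A B : set V) : set V :=
  [set z : V | exists a b, [/\ A a, B b & z = a + b]].

Section Smooth.
Context (R : realType) (n : nat).

Fixpoint Ck (k : nat) (O : set 'rV[R]_n) (f : 'rV[R]_n -> R) : Prop :=
  (forall y, O y -> {for y, continuous f}) /\
  (if k is k'.+1 then
     forall i : 'I_n,
       (forall y, O y -> derivable f y (delta_mx 0 i)) /\
       Ck k' O (fun y => 'D_(delta_mx 0 i) f y)
   else True).

Definition Cinfty (O : set 'rV[R]_n) (f : 'rV[R]_n -> R) : Prop :=
  forall k, Ck k O f.

(** [cmapf] and [cinvf] only matter on [cdom] and [cmapf @` cdom]. *)
Record chart (M : topologicalType) := Chart {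
  cdom : set M;
  cmapf : M -> 'rV[R]_n;
  cinvf : 'rV[R]_n -> M;
  cdom_open : open cdom;
  cimg_open : open (cmapf @` cdom);
  cmapfK : forall x, cdom x -> cinvf (cmapf x) = x;
  cmapf_continuous : forall x, cdom x -> {for x, continuous cmapf};
  cinvf_continuous : forall y, (cmapf @` cdom) y -> {for y, continuous cinvf}
}.

Record manifold := Manifold {
  carrier :> topologicalType;
  atlas : set (chart carrier);
  manifold_hausdorff : hausdorff_space carrier;
  manifold_second_countable : @second_countable carrier;
  atlas_cover : forall x, exists2 c, atlas c & cdom c x;
  atlas_compatible : forall c c', atlas c -> atlas c' -> forall i : 'I_n,
        Cinfty (cmapf c @` (cdom c `&` cdom c'))
               (fun y => cmapf c' (cinvf c y) 0 i)
}.

End Smooth.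

Section VectorFields.
Context (R : realType) (n : nat) (M : manifold R n).

Definition smooth_on (U : set M) (f : M -> R) : Prop :=
  forall c, atlas c ->
    Cinfty (cmapf c @` (cdom c `&` U)) (f \o cinvf c).

Definition smooth (f : M -> R) : Prop := smooth_on setT f.

(** Tangent vectors are the derivations of the algebra of smooth functions.
    Extending them by [0] to all functions makes each tangent space a linear
    subspace of the fixed real vector space [(M -> R) -> R]. *)
Definition Tvec : Type := (M -> R) -> R.

Definition tangent (x : M) : set Tvec := [set v : Tvec |
  [/\ forall (a : R) f g, smooth f -> smooth g ->
        v (fun y => a * f y + g y) = a * v f + v g,
      forall f g, smooth f -> smooth g ->
        v (fun y => f y * g y) = f x * v g + g x * v f &
      forall f, ~ smooth f -> v f = 0]].

Definition field : Type := M -> Tvec.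

Definition vfield_on (U : set M) (X : field) : Prop :=
  (forall x, U x -> tangent x (X x)) /\
  (forall f, smooth f -> smooth_on U (fun x => X x f)).

Definition vfield (X : field) : Prop := vfield_on setT X.

Definition lie (X Y : field) : field := fun x f =>
  X x (fun y => Y y f) - Y x (fun y => X y f).

(** A complex vector field is an element [(X, Y)] of [cplx field]. *)
Definition ceval (x : M) : cplx field -> cplx Tvec := cmap (fun X : field => X x).

Definition clie : cplx field -> cplx field -> cplx field := cbil lie.

Definition is_basis (K : fieldType) (V : lmodType K) (r : nat)
    (E : set V) (e : 'I_r -> V) : Prop :=
  (forall v, E v <-> exists a : 'I_r -> K, v = \sum_i a i *: e i) /\
  (forall a : 'I_r -> K, \sum_i a i *: e i = 0 -> forall i, a i = 0).

Definition real_distribution (r : nat) (E : M -> set Tvec) : Prop :=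
  forall x, exists (U : set M) (e : 'I_r -> field),
    [/\ open U, U x, forall i, vfield_on U (e i) &
        forall y, U y -> is_basis (E y) (fun i => e i y)].

(** Complex rank [r] subbundles of the complexified tangent bundle. *)
Definition complex_distribution (r : nat) (E : M -> set (cplx Tvec)) : Prop :=
  forall x, exists (U : set M) (e : 'I_r -> cplx field),
    [/\ open U, U x,
        forall i, vfield_on U (e i).1 /\ vfield_on U (e i).2 &
        forall y, U y -> is_basis (E y) (fun i => ceval y (e i))].

Definition sections (E : M -> set Tvec) : set field :=
  [set X | vfield X /\ forall x, E x (X x)].

Definition csections (E : M -> set (cplx Tvec)) : set (cplx field) :=
  [set Z : cplx field | [/\ vfield Z.1, vfield Z.2 & forall x, E x (ceval x Z)]].

Definition eigen10 (D : M -> set Tvec) (J : M -> Tvec -> Tvec) (x : M) :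
    set (cplx Tvec) :=
  [set z : cplx Tvec | [/\ D x z.1, D x z.2 & cmap (J x) z = 'i%C *: z]].

(** [crJ x] only matters on [crD x]. *)
Record CR_structure := CRStructure {
  crD : M -> set Tvec;
  crJ : M -> Tvec -> Tvec;
  crD_distr : exists r : nat, real_distribution r.*2 crD;
  crJ_crD : forall x v, crD x v -> crD x (crJ x v);
  crJ_linear : forall x (a : R) v w, crD x v -> crD x w ->
        crJ x (a *: v + w) = a *: crJ x v + crJ x w;
  crJ_sqr : forall x v, crD x v -> crJ x (crJ x v) = - v;
  crJ_smooth : forall X, sections crD X -> vfield (fun x => crJ x (X x));
  cr_involutive : forall Z W, csections (eigen10 crD crJ) Z ->
        csections (eigen10 crD crJ) W ->
        csections (eigen10 crD crJ) (clie Z W)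
}.

Section CR.
Variable S : CR_structure.

Definition D10 (x : M) : set (cplx Tvec) := eigen10 (crD S) (crJ S) x.
Definition D01 (x : M) : set (cplx Tvec) := @cconj Tvec @` D10 x.

(** Both sequences start in degree [-1]: [tanaka_mod j] has degree [-1 - j]
    and [freeman_mod j] has degree [j - 1]. *)
Fixpoint tanaka_mod (j : nat) : set field :=
  if j is j'.+1 then
    [set Z | exists (A : field) (N : nat) (X Y : 'I_N -> field),
      [/\ tanaka_mod j' A, forall i, sections (crD S) (X i),
          forall i, tanaka_mod j' (Y i) &
          Z = A + \sum_(i < N) lie (X i) (Y i)]]
  else sections (crD S).

Fixpoint freeman_mod (j : nat) : set (cplx field) :=
  if j is j'.+1 then
    [set X | freeman_mod j' X /\
      forall Y, csections D01 Y ->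
        setsum (freeman_mod j') (csections D01) (clie X Y)]
  else csections D10.

(** Regularity: the modules above are the section spaces of distributions.
    For the Freeman sequence this has to be understood fibrewise, i.e. the
    fibre in each degree is the kernel at [x] of the higher order Levi form
    of the previous degree (field [freeman_kernel]); equivalently these forms
    have constant rank.  It does not follow from the condition on sections:
    for the hypersurface [Im w = |z1|^2 + |z2|^4] the sections in the kernel
    of the Levi form vanish identically, but its kernel at [0] does not. *)
Record regular_CR := RegularCR {
  tanaka_nat : nat -> M -> set Tvec;
  freeman_nat : nat -> M -> set (cplx Tvec);
  tanaka_distr : forall j, exists r, real_distribution r (tanaka_nat j);
  tanaka_sections : forall j, tanaka_mod j = sections (tanaka_nat j);
  freeman_distr : forall j, exists r, complex_distribution r (freeman_nat j);
  freeman_sections : forall j, freeman_mod j = csections (freeman_nat j);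
  freeman_kernel : forall j X x, freeman_mod j X ->
    (forall Y, csections D01 Y ->
       setsum (freeman_nat j x) (D01 x) (ceval x (clie X Y))) ->
    freeman_nat j.+1 x (ceval x X)
}.

Variable C : regular_CR.

(** [D_p] and its sections for [p <= -1]; [F_p^10], its sections, [F_p] and
    [Re F_p] for [p >= -1].  Since [D_p] and [F_p^10] both start in degree
    [-1], the position in either sequence is [absz (p + 1)]. *)
Definition tanakaD (p : int) (x : M) : set Tvec := tanaka_nat C (absz (p + 1)) x.
Definition tanaka_sec (p : int) : set field := tanaka_mod (absz (p + 1)).

Definition freeman10 (p : int) (x : M) : set (cplx Tvec) :=
  freeman_nat C (absz (p + 1)) x.
Definition freeman_sec (p : int) : set (cplx field) := freeman_mod (absz (p + 1)).

Definition freemanF (p : int) (x : M) : set (cplx Tvec) :=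
  setsum (freeman10 p x) (@cconj Tvec @` freeman10 p x).

Definition reF (p : int) (x : M) : set Tvec :=
  [set v : Tvec | freemanF p x (v, 0)].

Definition nondegenerate_CR (k : nat) : Prop :=
  (forall p : int, -1 <= p -> p <= k%:Z - 2 ->
     exists x z, freemanF p x z /\ z <> 0) /\
  (forall x z, freemanF (k%:Z - 1) x z -> z = 0).

Definition mx_num (x : M) (p : int) : set Tvec :=
  if p <= -2 then tanakaD p x else reF p x.

Definition mx_den (x : M) (p : int) : set Tvec :=
  if p <= -2 then tanakaD (p + 1) x else reF (p + 1) x.

End CR.
End VectorFields.

(** [proj] presents [V] as the quotient of the subspace [A] by the subspace [B];
    it only matters on [A]. *)
Definition is_quotient (R : realType) (T V : lmodType R)
    (A B : set T) (proj : T -> V) : Prop :=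
  [/\ forall (a : R) u v, A u -> A v -> proj (a *: u + v) = a *: proj u + proj v,
      forall y, exists2 u, A u & proj u = y &
      forall u, A u -> (proj u = 0 <-> B u)].

(** [gbr p q r u v] is the degree [r] component of [[u, v]]; it is used for
    [p, q < 0] only.  Letting [r] be arbitrary (with value [0] unless
    [r = p + q]) avoids casts between [gr (p + (q + r))] and
    [gr ((p + q) + r)].  Similarly [gJ p] is used for [p >= -1], and
    [gL p], which is [L^{p+2}] in uncurried form, for [p >= 0]. *)
Record core_data (R : realType) := CoreData {
  gr :> int -> vectType R;
  gJ : forall p, gr p -> gr p;
  gbr : forall p q r, gr p -> gr q -> gr r;
  gL : forall p, cplx (gr p) -> cplx (gr (-1)) -> cplx (gr (p - 1))
}.

Section Core.
Context (R : realType) (m : core_data R).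

Definition m10 (p : int) : set (cplx (m p)) :=
  [set z : cplx (m p) | cmap (@gJ _ m p) z = 'i%C *: z].

Definition m01 (p : int) : set (cplx (m p)) :=
  [set z : cplx (m p) | cmap (@gJ _ m p) z = - 'i%C *: z].

Definition cgbr p q r : cplx (m p) -> cplx (m q) -> cplx (m r) :=
  cbil (@gbr _ m p q r).

(** The multilinear map [m^{-1(01)} x ... x m^{-1(01)} -> m^{-2} (x) C] defined
    by [z] of degree [p >= -1]: it has [p + 2] arguments, all of which but the
    last are absorbed by the maps [gL], and the last one by the bracket. *)
Fixpoint gL_iter (p : int) (z : cplx (m p)) (ws : seq (cplx (m (-1)))) :
    cplx (m (-2)) :=
  match ws with
  | [::] => 0
  | [:: w] => cgbr (-2) z w
  | w :: ws' => gL_iter (gL z w) ws'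
  end.

Record is_core : Prop := IsCore {
  core_finite : exists N : nat, forall p : int, (N < `|p|)%N ->
    forall v : m p, v = 0;

  core_J_linear : forall p : int, -1 <= p -> linear (@gJ _ m p);
  core_J_sqr : forall p : int, -1 <= p -> forall v : m p, gJ (gJ v) = - v;

  core_br_linearl : forall p q r : int, p < 0 -> q < 0 ->
    forall v : m q, linear (fun u : m p => gbr r u v);
  core_br_linearr : forall p q r : int, p < 0 -> q < 0 ->
    forall u : m p, linear (fun v : m q => gbr r u v);
  core_br_graded : forall p q r : int, p < 0 -> q < 0 -> r != p + q ->
    forall (u : m p) (v : m q), gbr r u v = 0;
  core_br_antisym : forall p q r : int, p < 0 -> q < 0 ->
    forall (u : m p) (v : m q), gbr r u v = - gbr r v u;
  core_br_jacobi : forall p q r : int, p < 0 -> q < 0 -> r < 0 ->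
    forall (u : m p) (v : m q) (w : m r),
      gbr (p + q + r) u (gbr (q + r) v w)
      + gbr (p + q + r) v (gbr (r + p) w u)
      + gbr (p + q + r) w (gbr (p + q) u v) = 0;
  core_br_J : forall v w : m (-1), gbr (-2) (gJ v) (gJ w) = gbr (-2) v w;
  core_fundamental : forall A : (forall p, {vspace m p}),
    (forall v : m (-1), v \in A (-1)) ->
    (forall (p q : int) (u : m p) (v : m q), p < 0 -> q < 0 ->
       u \in A p -> v \in A q -> gbr (p + q) u v \in A (p + q)) ->
    forall (p : int) (v : m p), p < 0 -> v \in A p;
  core_nondegenerate : forall v : m (-1),
    (forall w : m (-1), gbr (-2) v w = 0) -> v = 0;

  core_L_range : forall p : int, 0 <= p ->
    forall (z : cplx (m p)) w, m10 z -> m01 w -> m10 (gL z w);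
  core_L_linearl : forall p : int, 0 <= p ->
    forall (a : R[i]) (z z' : cplx (m p)) w, m10 z -> m10 z' -> m01 w ->
      gL (a *: z + z') w = a *: gL z w + gL z' w;
  core_L_linearr : forall p : int, 0 <= p ->
    forall (a : R[i]) (z : cplx (m p)) w w', m10 z -> m01 w -> m01 w' ->
      gL z (a *: w + w') = a *: gL z w + gL z w';
  core_L_sym : forall p : int, 0 <= p ->
    forall (z : cplx (m p)) ws ws', m10 z -> (forall w, w \in ws -> m01 w) ->
      size ws = (`|p|.+2)%N -> perm_eq ws ws' -> gL_iter z ws = gL_iter z ws';
  core_L_inj : forall p : int, 0 <= p ->
    forall z z' : cplx (m p), m10 z -> m10 z' ->
      (forall w, m01 w -> gL z w = gL z' w) -> z = z'
}.

Definition has_depth (mu : nat) : Prop :=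
  forall p : int, p < - mu%:Z -> forall v : m p, v = 0.

Definition has_height (h : int) : Prop :=
  forall p : int, h < p -> forall v : m p, v = 0.

End Core.

(** The operations of [m] are those induced, through the projections [proj p]
    from [mx_num C x p] to [m p], by [J], by commutators, and by the higher
    order Levi forms.  In the last clause [Z] is the component in
    [F_{p-1}^10] at [x] of the value of [[X, Y]] in
    [F_{p-1}^10 (+) D^01]. *)
Definition natural_core (R : realType) (n : nat) (M : manifold R n)
    (S : CR_structure M) (C : regular_CR S) (x : M)
    (m : core_data R) (proj : forall p, Tvec M -> m p) : Prop :=
  [/\ forall p : int, -1 <= p -> forall v, mx_num C x p v ->
        gJ (proj p v) = proj p (crJ S x v),
      forall (p q : int) (X Y : field M), p < 0 -> q < 0 ->
        tanaka_sec S p X -> tanaka_sec S q Y ->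
        gbr (p + q) (proj p (X x)) (proj q (Y x)) = proj (p + q) (lie X Y x) &
      forall (p : int) (X Y : cplx (field M)) (Z : cplx (Tvec M)), 0 <= p ->
        freeman_sec S p X -> csections (D01 S) Y ->
        freeman10 C (p - 1) x Z -> D01 S x (ceval x (clie X Y) - Z) ->
        gL (cmap (proj p) (ceval x X)) (cmap (proj (-1)) (ceval x Y))
        = cmap (proj (p - 1)) Z].

(* Main.v *)
Require Import Defs.
From HB Require Import structures.
From mathcomp Require Import all_boot all_order all_algebra.
From mathcomp Require Import all_classical all_reals all_analysis.
From mathcomp Require Import complex.
From mathcomp Require Import ring lra zify.
Import numFieldNormedType.Exports.
Import Order.TTheory GRing.Theory Num.Theory.

Local Open Scope classical_set_scope.
Local Open Scope ring_scope.

Set Implicit Arguments.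
Unset Strict Implicit.
Unset Printing Implicit Defensive.

(** The core [m_x] carries three operations, each induced by an operation on
    sections: the complex structure [J], the commutator, and the higher order
    Levi forms.  What has to be shown is that these are well defined on the
    quotients; the axioms of an abstract core then follow from the Jacobi
    identity, the involutivity of [D^10] and the definitions of the two
    sequences.

    Two facts about a subbundle [E] pass from sections to fibres.  Every vector
    of a fibre is the value of a global section ([distr_section], by bump
    functions), and a section that vanishes at [x] is a combination of sections
    of [E] with smooth coefficients that vanish at [x] ([section_hadamard], by
    Cramer's rule).  By the derivation property of the bracket, replacing [X] by
    a section of [E] with the same value at [x] therefore changes [[X, Y]] at
    [x] only by an element of [E_x].

    Hence an operation is well defined as soon as it is compatible with the
    filtrations at the level of sections.  For the commutator this means
    [[D_p, D_q]] inside [D_(p+q)] ([tanaka_bracket]) and, as [m^(-1)] is the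
    quotient by the Levi kernel, that [Re F_0] preserves each [D_q]
    ([levi_kernel_tanaka]).  For the Levi form of [F_p^10] with [D^01] it means
    that [F_(p+1)^10] is killed, which is the definition, and that so is the
    conjugate of [F_0^10]: [[F_p^10, conj F_0^10]] lies in [F_p^10 + D^01]
    ([freeman_conj_bracket], by induction on [p] from the Jacobi identity).

    The Freeman bundles are handled through their real forms [Re F_p]: a vector
    of type (1,0) is [v - iJv], so it is determined by its real part.

    The higher order Levi form [L^(p+2)] is symmetric because two successive
    brackets with [Y] and [Y'] in [D^01] differ from the brackets in the other
    order by a bracket with [[Y, Y']], again in [D^01] ([levi_swap]), and any
    permutation is a product of exchanges of neighbours
    ([perm_eq_neighbours]).  It is injective because the fibre of [F_(p+1)^10]
    is the kernel of the form at [x] (field [freeman_kernel]); in degree [-1]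
    this gives the nondegeneracy of the bracket ([levi_nondegenerate]).  The
    negative part is generated in degree [-1] by the recursion that defines the
    Tanaka sequence ([core_generated]), and depth and height are read off from
    [D_(-mu) = TM] and [F_(k-1) = 0]. *)

(** * Functions of class C^k on open sets of R^n *)

Section Calculus.
Context (R : realType) (n : nat).
Implicit Types (O : set 'rV[R]_n) (f g : 'rV[R]_n -> R).

Lemma Ck_eq k O f g : open O -> (forall y, O y -> f y = g y) ->
  Ck k O f -> Ck k O g.
Proof.
move=> oO; have near_eq (f1 g1 : 'rV[R]_n -> R) y :
    (forall z, O z -> f1 z = g1 z) -> O y -> {near y, f1 =1 g1}.
  move=> fg Oy; have nO : nbhs y O by apply: open_nbhs_nbhs; split.
  by apply: filterS nO.
have cont_eq (f1 g1 : 'rV[R]_n -> R) : (forall z, O z -> f1 z = g1 z) ->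
    (forall y, O y -> {for y, continuous f1}) ->
    forall y, O y -> {for y, continuous g1}.
  move=> fg cf y Oy; rewrite /prop_for /continuous_at -fg//.
  apply: cvg_trans (cf _ Oy); exact: (near_eq_cvg (near_eq _ _ _ fg Oy)).
elim: k f g => [|k IHk] f g fg [cf df]; split=> //; try exact: cont_eq fg cf.
move=> i; have [dfi Cdf] := df i; split=> [y Oy|].
  exact: near_eq_derivable (near_eq _ _ _ fg Oy) (dfi y Oy).
apply: IHk Cdf => y Oy; apply: near_eq_derive; exact: near_eq Oy.
Qed.

Lemma Ck_sub k O O' f : O' `<=` O -> Ck k O f -> Ck k O' f.
Proof.
move=> sO; elim: k f => [|k IHk] f [cf df]; split=> //.
- by move=> y /sO; exact: cf.
- by move=> y /sO; exact: cf.
- by move=> i; have [d1 d2] := df i; split=> [y /sO|]; [exact: d1|exact: IHk].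
Qed.

Lemma Ck_union k O O' f : Ck k O f -> Ck k O' f -> Ck k (O `|` O') f.
Proof.
elim: k f => [|k IHk] f [cf df] [cf' df']; split=> //.
- by move=> y [/cf|/cf'].
- by move=> y [/cf|/cf'].
- move=> i; have [d1 d2] := df i; have [d1' d2'] := df' i.
  by split=> [y [/d1|/d1']|] //; exact: IHk.
Qed.

Lemma Ck_pred k O f : Ck k.+1 O f -> Ck k O f.
Proof.
elim: k f => [|k IHk] f [cf df]; split=> // i.
by have [d1 d2] := df i; split=> //; exact: IHk.
Qed.

Lemma Ck_cst k O (a : R) : Ck k O (fun=> a).
Proof.
elim: k a => [|k IHk] a; split=> //.
- by move=> y _; exact: cst_continuous.
- by move=> y _; exact: cst_continuous.
- move=> i; split=> [y _|]; first exact: derivable_cst.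
  have -> : (fun y : 'rV[R]_n => 'D_(delta_mx 0 i) (fun=> a) y) = (fun=> 0 : R).
    by apply: funext => y; exact: derive_cst.
  exact: IHk.
Qed.

Lemma CkS k O f : Ck k.+1 O f <-> (forall y, O y -> {for y, continuous f}) /\
  forall i, (forall y, O y -> derivable f y (delta_mx 0 i)) /\
    Ck k O (fun y : 'rV[R]_n => 'D_(delta_mx 0 i) f y).
Proof. by []. Qed.

Lemma CkD k O f g : open O -> Ck k O f -> Ck k O g ->
  Ck k O (fun y => f y + g y).
Proof.
move=> oO; elim: k f g => [|k IHk] f g.
  by move=> [cf _] [cg _]; split=> // y Oy; exact: (cvgD (cf _ Oy) (cg _ Oy)).
move=> /CkS[cf df] /CkS[cg dg]; apply/CkS; split.
  by move=> y Oy; exact: (cvgD (cf _ Oy) (cg _ Oy)).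
move=> i; have [f1 f2] := df i; have [g1 g2] := dg i.
split=> [y Oy|]; first by apply: derivableD; [exact: f1|exact: g1].
apply: (Ck_eq oO _ (IHk _ _ f2 g2)) => y Oy.
by rewrite -deriveD//; [exact: f1|exact: g1].
Qed.

Lemma CkM k O f g : open O -> Ck k O f -> Ck k O g ->
  Ck k O (fun y => f y * g y).
Proof.
move=> oO; elim: k f g => [|k IHk] f g Cf Cg.
  by split=> // y Oy; exact: (cvgM (Cf.1 _ Oy) (Cg.1 _ Oy)).
have Cf' := Ck_pred Cf; have Cg' := Ck_pred Cg.
have [cf df] := (CkS _ _ _).1 Cf; have [cg dg] := (CkS _ _ _).1 Cg.
apply/CkS; split; first by move=> y Oy; exact: (cvgM (cf _ Oy) (cg _ Oy)).
move=> i; have [f1 f2] := df i; have [g1 g2] := dg i.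
split=> [y Oy|]; first by apply: derivableM; [exact: f1|exact: g1].
apply: (Ck_eq oO _ (CkD oO (IHk _ _ Cf' g2) (IHk _ _ Cg' f2))) => y Oy.
exact: esym (deriveM (f1 _ Oy) (g1 _ Oy)).
Qed.

End Calculus.

Section ChainRule.
Context (R : realType) (V : normedModType R).

Lemma derive_line (f : V -> R) (a v : V) :
  'D_v f a = 'D_1 (fun t : R => f (t *: v + a)) 0.
Proof.
rewrite /derive; set g1 := fun h => h^-1 *: _; set g2 := fun h => h^-1 *: _.
suff -> : g1 = g2 by [].
by rewrite funeqE /g1 /g2 => h /=; rewrite addr0 scale0r add0r [_%:A]mulr1.
Qed.

(** Restricting to the line through [a] reduces the chain rule to one variable:
    only the derivative of [g] in the direction [v] is involved. *)
Lemma is_derive_comp1 (h : R -> R) (dh : R) (g : V -> R) (a v : V) :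
  is_derive (g a) 1 h dh -> derivable g a v ->
  is_derive a v (h \o g) (dh * 'D_v g a).
Proof.
move=> [dh1 dhE] /derivable1P dg.
have E0 : g (0 *: v + a) = g a by rewrite scale0r add0r.
have dh0 : derivable h ((fun t : R => g (t *: v + a)) 0) 1 by rewrite E0.
split.
  apply/derivable1P/derivable1_diffP.
  apply: (@differentiable_comp _ _ _ _ (fun t : R => g (t *: v + a)) h).
    exact/derivable1_diffP.
  exact/derivable1_diffP.
rewrite !derive_line -dhE -!derive1E.
by rewrite [LHS](derive1_comp dg dh0) E0.
Qed.

End ChainRule.

(** * Functions that are flat at the origin *)

Section FlatFunctions.
Context (R : realType).

(** The functions [t^-m exp(-1/t)], extended by [0] to [t <= 0].  The family in
    [m] is closed under differentiation up to linear combinations, which is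
    why the powers of [1/t] are included. *)
Definition flatexp (m : nat) (t : R) : R :=
  if 0 < t then t^-1 ^+ m * expR (- t^-1) else 0.

(** With [s = 1/t] this is [s^(m+2) <= (m+2)! exp s].  The factor [t^2] makes
    the derivative at [0] vanish. *)
Lemma flatexp_le m t : `|flatexp m t| <= (m.+2)`!%:R * t ^+ 2.
Proof.
rewrite /flatexp; case: ifPn => [t0|_]; last first.
  by rewrite normr0 mulr_ge0// sqr_ge0.
have s0 : 0 < t^-1 by rewrite invr_gt0.
rewrite ger0_norm; last by rewrite mulr_ge0 ?exprn_ge0 ?expR_ge0// ltW.
have /(le_trans _) le1 := expR_ge1Dxn m.+1 (ltW s0).
have {}le1 : t^-1 ^+ m.+2 <= (m.+2)`!%:R * expR t^-1.
  rewrite -ler_pdivrMl ?ltr0n ?fact_gt0// mulrC.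
  by apply: le1; rewrite lerDr.
rewrite expRN ler_pdivrMr ?expR_gt0// mulrAC.
rewrite -ler_pdivrMr ?exprn_gt0//.
by rewrite -exprVn -exprD addn2.
Qed.

Lemma is_derive_flatexp (m : nat) (t : R) :
  is_derive t (1 : R) (flatexp m) (flatexp m.+2 t - m%:R * flatexp m.+1 t).
Proof.
have [t0|t0|->] := ltgtP t 0.
- apply: (@near_eq_is_derive _ _ _ (cst 0)).
    near=> z; rewrite /flatexp ifF//; apply/negbTE; rewrite -leNgt ltW//.
    by near: z; exact: lt_nbhsl.
  by rewrite /flatexp ltNge ltW//= mulr0 subr0; exact: is_derive_cst.
- apply: (@near_eq_is_derive _ _ _ (fun z : R => z^-1 ^+ m * expR (- z^-1))).
    near=> z; rewrite /flatexp ifT//.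
    by near: z; exact: lt_nbhsr.
  have tn0 : t != 0 by rewrite gt_eqF.
  have dV : is_derive t (1 : R) (fun z : R => z^-1) (- t ^- 2).
    have := @is_deriveV R id t 1 1 tn0 (is_derive_id _ _).
    by rewrite [_ *: _]mulr1.
  rewrite /flatexp t0.
  have dN : is_derive t (1 : R) (fun z : R => - z^-1) (t ^- 2).
    rewrite -[t ^- 2]opprK; exact: is_deriveN.
  have dE : is_derive t (1 : R) (expR \o (fun z : R => - z^-1))
      (expR (- t^-1) * t ^- 2) by exact: is_derive1_comp.
  have dX : is_derive t (1 : R) (fun z : R => z^-1 ^+ m)
      ((m%:R * t^-1 ^+ m.-1) *: (- t ^- 2)).
    have -> : (fun z : R => z^-1 ^+ m) = (fun z : R => z^-1) ^+ m.
      by apply: funext => z; rewrite exprfctE.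
    exact: is_deriveX.
  apply: (is_derive_eq (is_deriveM dX dE)).
  rewrite /=; case: (m) => [|m'] /=.
    rewrite !mul0r scale0r scaler0 subr0 addr0 expr0 [_ *: _]mul1r mulrC.
    by rewrite exprVn.
  rewrite -!exprVn; set s := t^-1; rewrite /GRing.scale/= !exprS.
  by set E := expR _; ring.
- have f0 k : flatexp k 0 = 0 by rewrite /flatexp ltxx.
  rewrite !f0 mulr0 subr0.
  have cv : (fun h : R => h^-1 *: ((flatexp m \o shift 0) (h *: 1) - flatexp m 0))
      @ 0^' --> (0 : R).
    apply/cvgr0Pnorm_lt => e e0.
    have c0 : 0 < (m.+2)`!%:R :> R by rewrite ltr0n fact_gt0.
    near=> h.
    have hn0 : h != 0 by near: h; exact: nbhs_dnbhs_neq.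
    rewrite f0 subr0 /= addr0 [_ *: 1]mulr1 normrM normfV.
    rewrite ltr_pdivrMl ?normr_gt0//.
    apply: (le_lt_trans (flatexp_le _ _)).
    rewrite -real_normK ?num_real// expr2 mulrCA ltr_pM2l ?normr_gt0//.
    rewrite -ltr_pdivlMl// mulrC.
    by near: h; apply: dnbhs0_lt; rewrite divr_gt0.
  split; first by apply/cvg_ex; exists 0.
  exact: cvg_lim cv.
Unshelve. all: by end_near. Qed.

Lemma flatexp_continuous m : continuous (flatexp m).
Proof.
move=> t; apply/differentiable_continuous/derivable1_diffP.
by have [] := is_derive_flatexp m t.
Qed.

(** All [m] have to be treated at once, because the derivative of [flatexp m]
    involves [flatexp m.+1] and [flatexp m.+2]. *)
Lemma Ck_flatexp n k m (O : set 'rV[R]_n) (g : 'rV[R]_n -> R) : open O ->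
  Ck k O g -> Ck k O (fun y => flatexp m (g y)).
Proof.
move=> oO; elim: k m g => [|k IHk] m g Cg.
  split=> // y Oy; apply: (@continuous_comp _ _ _ g (flatexp m)).
    exact: Cg.1.
  exact: flatexp_continuous.
have Cg' := Ck_pred Cg; have [cg dg] := (CkS _ _ _).1 Cg.
apply/CkS; split.
  move=> y Oy; apply: (@continuous_comp _ _ _ g (flatexp m)).
    exact: cg.
  exact: flatexp_continuous.
move=> i; have [g1 g2] := dg i.
have dcomp y : O y -> is_derive y (delta_mx 0 i) (flatexp m \o g)
    ((flatexp m.+2 (g y) - m%:R * flatexp m.+1 (g y)) * 'D_(delta_mx 0 i) g y).
  by move=> Oy; apply: is_derive_comp1; [exact: is_derive_flatexp|exact: g1].
split=> [y Oy|]; first by have [] := dcomp y Oy.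
have Cm := CkM oO (Ck_cst k O (- m%:R)) (IHk m.+1 g Cg').
apply: (Ck_eq oO _ (CkM oO (CkD oO (IHk m.+2 g Cg') Cm) g2)) => y Oy.
by have [_ /esym] := dcomp y Oy; rewrite mulNr.
Qed.

End FlatFunctions.

(** * Smooth functions and bump functions on a manifold *)

Section SmoothFunctions.
Context (R : realType) (n : nat) (M : manifold R n).
Implicit Types (U : set M) (f g : M -> R).

Lemma chart_image_open (c : chart R n M) U : open U ->
  open (cmapf c @` (cdom c `&` U)).
Proof.
move=> oU; rewrite openE => _ [y [cy Uy] <-].
have cK := cmapfK cy.
have img : (cmapf c @` cdom c) (cmapf c y) by exists y.
have n1 : nbhs (cmapf c y) (cmapf c @` cdom c).
  by apply: open_nbhs_nbhs; split => //; exact: cimg_open.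
have n2 : nbhs (cmapf c y) (cinvf c @^-1` U).
  apply: (cinvf_continuous img); rewrite cK.
  by apply: open_nbhs_nbhs; split.
apply: filterS2 n1 n2 => _ [z cz <-]; rewrite /= cmapfK// => Uz.
by exists z.
Qed.

Lemma smooth_on_sub U U' f : U' `<=` U -> smooth_on U f -> smooth_on U' f.
Proof.
move=> sU sf c ac k; apply: Ck_sub (sf c ac k).
by apply: image_subset => y [cy /sU].
Qed.

Lemma smooth_on_smooth U f : smooth f -> smooth_on U f.
Proof. exact: smooth_on_sub. Qed.

Lemma smooth_on_union U U' f :
  smooth_on U f -> smooth_on U' f -> smooth_on (U `|` U') f.
Proof.
move=> sf sf' c ac k; rewrite setIUr image_setU.
by apply: Ck_union; [exact: sf|exact: sf'].
Qed.

Lemma smooth_on_eq U f g : open U -> (forall y, U y -> f y = g y) ->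
  smooth_on U f -> smooth_on U g.
Proof.
move=> oU fg sf c ac k; apply: (Ck_eq _ _ (sf c ac k)).
  exact: chart_image_open.
by move=> _ [y [cy Uy] <-] /=; rewrite cmapfK// fg.
Qed.

Lemma smooth_on_cst U (a : R) : smooth_on U (fun=> a).
Proof. by move=> c ac k; exact: Ck_cst. Qed.

Lemma smooth_onD U f g : open U -> smooth_on U f -> smooth_on U g ->
  smooth_on U (fun y => f y + g y).
Proof.
move=> oU sf sg c ac k.
by have := CkD (chart_image_open oU) (sf c ac k) (sg c ac k).
Qed.

Lemma smooth_onM U f g : open U -> smooth_on U f -> smooth_on U g ->
  smooth_on U (fun y => f y * g y).
Proof.
move=> oU sf sg c ac k.
by have := CkM (chart_image_open oU) (sf c ac k) (sg c ac k).
Qed.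

Lemma smooth_onB U f g : open U -> smooth_on U f -> smooth_on U g ->
  smooth_on U (fun y => f y - g y).
Proof.
move=> oU sf sg; have := smooth_onD oU sf (smooth_onM oU (smooth_on_cst U (-1)) sg).
by apply: smooth_on_eq => // y _; rewrite mulN1r.
Qed.

Lemma smooth_on_sum U (I : Type) (r : seq I) (P : pred I) (F : I -> M -> R) :
  open U -> (forall i, smooth_on U (F i)) ->
  smooth_on U (fun y => \sum_(i <- r | P i) F i y).
Proof.
move=> oU sF; elim: r => [|i r IHr].
  apply: smooth_on_eq (smooth_on_cst U 0) => // y _.
  by rewrite big_nil.
apply: (@smooth_on_eq _ (fun y => (P i)%:R * F i y + \sum_(j <- r | P j) F j y)) => //.
  by move=> y _; rewrite big_cons; case: (P i); rewrite ?mul1r// mul0r add0r.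
by do 2?[apply: smooth_onD => //]; apply: smooth_onM => //; exact: smooth_on_cst.
Qed.

Lemma smooth_on_prod U (I : Type) (r : seq I) (F : I -> M -> R) :
  open U -> (forall i, smooth_on U (F i)) ->
  smooth_on U (fun y => \prod_(i <- r) F i y).
Proof.
move=> oU sF; elim: r => [|i r IHr].
  apply: smooth_on_eq (smooth_on_cst U 1) => // y _.
  by rewrite big_nil.
apply: (@smooth_on_eq _ (fun y => F i y * \prod_(j <- r) F j y)) => //.
  by move=> y _; rewrite big_cons.
exact: smooth_onM.
Qed.

Lemma smooth_on_det U r (A : M -> 'M[R]_r) : open U ->
  (forall i j, smooth_on U (fun y => A y i j)) ->
  smooth_on U (fun y => \det (A y)).
Proof.
move=> oU sA; apply: smooth_on_sum => // s.
apply: smooth_onM => //; first exact: smooth_on_cst.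
exact: smooth_on_prod.
Qed.

Lemma smooth_on_adj U r (A : M -> 'M[R]_r) i j : open U ->
  (forall i j, smooth_on U (fun y => A y i j)) ->
  smooth_on U (fun y => (\adj (A y)) i j).
Proof.
move=> oU sA.
apply: (@smooth_on_eq _ (fun y => cofactor (A y) j i)) => // [y _|].
  by rewrite mxE.
apply: smooth_onM => //; first exact: smooth_on_cst.
apply: smooth_on_det => // k l.
apply: (@smooth_on_eq _ (fun y => A y (lift j k) (lift i l))) => // y _.
by rewrite !mxE.
Qed.

Lemma smooth_on_coord (c : chart R n M) i : atlas c ->
  smooth_on (cdom c) (fun y => cmapf c y 0 i).
Proof. by move=> ac c' ac'; exact: atlas_compatible. Qed.

(** In a chart, [phi] is a multiple of [exp (-1 / (d^2 - |y - x|^2))].  Its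
    support lies in the compact image [K] of a closed cube; [K] is closed in
    the whole manifold by the Hausdorff property, so that extension by [0] is
    smooth, and [V] is its complement. *)
Lemma bump (x : M) U : open U -> U x ->
  exists phi : M -> R, exists2 V : set M, [/\ smooth phi & phi x = 1] &
    [/\ open V, U `|` V = setT & forall y, V y -> phi y = 0].
Proof.
move=> oU Ux; have [c ac cx] := atlas_cover x.
set p := cmapf c x.
have : nbhs p (cmapf c @` (cdom c `&` U)).
  by apply: open_nbhs_nbhs; split; [exact: chart_image_open|exists x].
move=> /nbhs_ballP[e /= e0 eU].
pose d := e / 2; have d0 : 0 < d by rewrite divr_gt0.
pose Kb : set 'rV[R]_n := [set v | forall i, `[p 0 i - d, p 0 i + d]%classic (v 0 i)].
have KbU : Kb `<=` cmapf c @` (cdom c `&` U).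
  move=> v Kv; apply: eU; split=> // i j; rewrite (ord1 i) /ball/=.
  have := Kv j; rewrite /= in_itv/= => /andP[l1 l2].
  rewrite ltr_norml; rewrite /d in l1 l2; apply/andP; split; lra.
have cKb : compact Kb.
  apply: (@rV_compact R n (fun i => `[p 0 i - d, p 0 i + d]%classic)) => i.
  exact: segment_compact.
pose K := cinvf c @` Kb.
have cK : compact K.
  apply: continuous_compact => //; apply: continuous_in_subspaceT => v.
  rewrite inE => /KbU[y [cy _] <-]; apply: cinvf_continuous.
  by exists y.
have clK : closed K by apply: compact_closed => //; exact: manifold_hausdorff.
have KU : K `<=` cdom c `&` U.
  by move=> _ [v /KbU[y [cy Uy] <-] <-]; rewrite cmapfK.
pose q (y : M) : R := d ^+ 2 - \sum_i (cmapf c y 0 i - p 0 i) ^+ 2.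
pose a := flatexp 0 (d ^+ 2); have a0 : a != 0.
  by rewrite /a /flatexp exprn_gt0// expr0 mul1r gt_eqF ?expR_gt0.
pose phi y : R := if y \in cdom c then a^-1 * flatexp 0 (q y) else 0.
have phi0 y : (~` K) y -> phi y = 0.
  move=> nKy; rewrite /phi; case: ifPn => // /set_mem cy.
  (* Outside the cube one coordinate alone exceeds [d], so [q y <= 0]. *)
  rewrite /flatexp ifF ?mulr0//; apply/negbTE; rewrite -leNgt subr_le0.
  have : ~ Kb (cmapf c y).
    by move=> Kby; apply: nKy; exists (cmapf c y) => //; rewrite cmapfK.
  move=> /existsNP[i /= /negP]; rewrite in_itv/= => ni.
  rewrite (bigD1 i)//=; apply: ler_wpDr; first by apply: sumr_ge0 => j _; exact: sqr_ge0.
  rewrite -(ger0_norm (ltW d0)) -[_ ^+ 2 in leRHS]real_normK ?num_real//.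
  rewrite ler_sqr ?nnegrE ?normr_ge0// ger0_norm ?ltW//.
  rewrite ltNge; apply: contra ni; rewrite ler_norml => /andP[l1 l2].
  by apply/andP; split; lra.
exists phi, (~` K); split.
- have cU := cdom_open c.
  have -> : smooth phi = smooth_on (cdom c `|` ~` K) phi.
    congr (smooth_on _ _); apply/esym/seteqP; split => // y _.
    by have [/KU[]|] := pselect (K y); [left|right].
  apply: smooth_on_union.
    apply: (@smooth_on_eq _ (fun y => a^-1 * flatexp 0 (q y))) => //.
      by move=> y cy; rewrite /phi mem_set.
    apply: smooth_onM => //; first exact: smooth_on_cst.
    move=> c' ac' k.
    apply: (@Ck_flatexp _ _ _ _ _ (q \o cinvf c')); first exact: chart_image_open.
    suff : smooth_on (cdom c) q by apply.
    apply: smooth_onB => //; first exact: smooth_on_cst.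
    apply: smooth_on_sum => // i.
    have sB : smooth_on (cdom c) (fun y => cmapf c y 0 i - p 0 i).
      by apply: smooth_onB => //; [exact: smooth_on_coord|exact: smooth_on_cst].
    exact: smooth_onM.
  apply: (@smooth_on_eq _ (fun=> 0)); last exact: smooth_on_cst.
    exact: closed_openC.
  by move=> y /phi0.
- rewrite /phi mem_set// /q big1 ?subr0 ?mulVf// => i _.
  by rewrite subrr expr0n.
- exact: closed_openC.
- apply/seteqP; split => // y _.
  by have [/KU[]|] := pselect (K y); [left|right].
- exact: phi0.
Qed.

Lemma smooth_cst (a : R) : smooth (fun _ : M => a).
Proof. exact: smooth_on_cst. Qed.

Lemma smoothM f g : smooth f -> smooth g -> smooth (fun y => f y * g y).
Proof. exact: smooth_onM openT. Qed.

Lemma smoothB f g : smooth f -> smooth g -> smooth (fun y => f y - g y).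
Proof. exact: smooth_onB openT. Qed.

Lemma smoothZ (a : R) f : smooth f -> smooth (fun y => a * f y).
Proof. exact/smoothM/smooth_cst. Qed.

End SmoothFunctions.

(** * Vector fields and their bracket *)

Section VectorFieldCalculus.
Context (R : realType) (n : nat) (M : manifold R n).
Implicit Types (U : set M) (f g : M -> R) (X Y Z : field M) (v w : Tvec M).

Lemma tangentD x v f g : tangent x v -> smooth f -> smooth g ->
  v (fun y => f y + g y) = v f + v g.
Proof.
move=> [vl _ _] sf sg; rewrite -[v f]mul1r -vl//.
by congr v; apply: funext => y; rewrite mul1r.
Qed.

Lemma tangentM x v f g : tangent x v -> smooth f -> smooth g ->
  v (fun y => f y * g y) = f x * v g + g x * v f.
Proof. by move=> [_ vM _]; exact: vM. Qed.

Lemma tangent_cst0 x v : tangent x v -> v (fun=> 0) = 0.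
Proof.
move=> tv; have s0 := @smooth_cst R n M 0.
have := tangentD tv s0 s0.
have -> : (fun y : M => 0 + 0) = (fun=> 0 : R) by apply: funext => y; rewrite addr0.
by move=> /(congr1 (fun z => z - v (fun=> 0))); rewrite addrK subrr.
Qed.

Lemma tangentZ x v (a : R) f : tangent x v -> smooth f ->
  v (fun y => a * f y) = a * v f.
Proof.
move=> tv sf; have s0 := @smooth_cst R n M 0.
have [vl _ _] := tv; have := vl a _ _ sf s0; rewrite (tangent_cst0 tv) addr0 => <-.
by congr v; apply: funext => y; rewrite addr0.
Qed.

Lemma tangentB x v f g : tangent x v -> smooth f -> smooth g ->
  v (fun y => f y - g y) = v f - v g.
Proof.
move=> tv sf sg; have sN : smooth (fun y => -1 * g y).
  exact: smoothZ.
rewrite -[- v g]mulN1r -(tangentZ _ tv sg) -(tangentD tv sf sN).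
by congr v; apply: funext => y; rewrite mulN1r.
Qed.

Lemma tangent_lin x (a : R) v w : tangent x v -> tangent x w ->
  tangent x (a *: v + w).
Proof.
move=> tv tw; split=> [b f g sf sg|f g sf sg|f nf].
- have [vl _ _] := tv; have [wl _ _] := tw.
  rewrite /= !fctE vl// wl//=.
  by rewrite /GRing.scale/=; ring.
- have [_ vl _] := tv; have [_ wl _] := tw.
  rewrite /= !fctE vl// wl//=.
  by rewrite /GRing.scale/=; ring.
- have [_ _ vl] := tv; have [_ _ wl] := tw.
  by rewrite !fctE vl// wl// scaler0 addr0.
Qed.

Lemma tangent0 x : tangent x (0 : Tvec M).
Proof. by split=> [a f g _ _|f g _ _|//]; rewrite /= !mulr0 addr0. Qed.

Lemma vfield_tangent X x : vfield X -> tangent x (X x).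
Proof. by move=> [tX _]; exact: tX. Qed.

(** Tangent vectors vanish on the functions that are not smooth. *)
Lemma vfield_on_smooth U X f : open U -> vfield_on U X ->
  smooth_on U (fun y => X y f).
Proof.
move=> oU [tX sX]; have [/sX//|nf] := pselect (smooth f).
apply: smooth_on_eq (smooth_on_cst _ 0) => // y Uy.
by have [_ _ ->] := tX y Uy.
Qed.

Lemma vfield_smooth X f : vfield X -> smooth (fun y => X y f).
Proof. by apply: vfield_on_smooth; exact: openT. Qed.

Lemma vfield_on_sub U X : vfield X -> vfield_on U X.
Proof.
move=> [tX sX]; split=> [x _|f /sX sf]; first exact: tX.
exact: smooth_on_smooth.
Qed.

Lemma vfield_on_lin U (a : R) X Y : open U -> vfield_on U X -> vfield_on U Y ->
  vfield_on U (a *: X + Y).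
Proof.
move=> oU vX vY; split=> [x Ux|f sf].
  by apply: tangent_lin; [exact: vX.1|exact: vY.1].
apply: (@smooth_on_eq _ _ _ _ (fun y => a * X y f + Y y f)) => //.
apply: smooth_onD => //; last exact: vY.2.
by apply: smooth_onM => //; [exact: smooth_on_cst|exact: vX.2].
Qed.

Lemma vfield_lin (a : R) X Y : vfield X -> vfield Y -> vfield (a *: X + Y).
Proof. exact: vfield_on_lin openT. Qed.

Lemma vfield_on0 U : open U -> vfield_on U 0.
Proof.
move=> oU; split=> [x _|f sf]; first exact: tangent0.
exact: (smooth_on_cst U 0).
Qed.

Lemma vfieldZ (a : R) X : vfield X -> vfield (a *: X).
Proof.
move=> vX; rewrite -[_ *: _]addr0; apply: vfield_lin => //.
exact: vfield_on0 openT.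
Qed.

Lemma vfieldD X Y : vfield X -> vfield Y -> vfield (X + Y).
Proof. by move=> vX vY; rewrite -[X]scale1r; exact: vfield_lin. Qed.

Lemma vfieldN X : vfield X -> vfield (- X).
Proof. by move=> vX; rewrite -scaleN1r; exact: vfieldZ. Qed.

Lemma vfieldB X Y : vfield X -> vfield Y -> vfield (X - Y).
Proof. by move=> vX /vfieldN; exact: vfieldD. Qed.

Lemma vfield_on_sum U (I : Type) (r : seq I) (P : pred I) (a : I -> R)
    (F : I -> field M) : open U -> (forall i, vfield_on U (F i)) ->
  vfield_on U (\sum_(i <- r | P i) a i *: F i).
Proof.
move=> oU vF; elim: r => [|i r IHr]; first by rewrite big_nil; exact: vfield_on0.
by rewrite big_cons; case: ifP => // _; exact: vfield_on_lin.
Qed.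

Definition fscale f X : field M := fun y => f y *: X y.

Lemma fscale_vfield f X : smooth f -> vfield X -> vfield (fscale f X).
Proof.
move=> sf vX; split=> [x _|g sg].
  rewrite -[fscale _ _ _]addr0; apply: tangent_lin; [exact: vX.1|exact: tangent0].
by apply: smoothM => //; exact: vX.2.
Qed.

(** Extension by zero across the open set [V] on which the coefficient vanishes. *)
Lemma cutoff_vfield U V f X : open U -> open V -> U `|` V = setT -> smooth f ->
  (forall y, V y -> f y = 0) -> vfield_on U X -> vfield (fscale f X).
Proof.
move=> oU oV UV sf f0 vX; split=> [x _|g sg].
  have : (U `|` V) x by rewrite UV.
  move=> [Ux|/f0 fx]; last by rewrite /fscale fx scale0r; exact: tangent0.
  rewrite -[fscale _ _ _]addr0; apply: tangent_lin; [exact: vX.1|exact: tangent0].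
rewrite -UV; apply: smooth_on_union.
  by apply: smooth_onM => //; [exact: smooth_on_smooth|exact: vX.2].
apply: (@smooth_on_eq _ _ _ _ (fun=> 0)) => //; last exact: smooth_on_cst.
by move=> y Vy; rewrite /fscale f0// scale0r.
Qed.

Lemma lie_vfield X Y : vfield X -> vfield Y -> vfield (lie X Y).
Proof.
move=> vX vY; split=> [x _|f sf]; last first.
  by apply: smoothB; exact: vfield_smooth.
have tX := vfield_tangent x vX; have tY := vfield_tangent x vY.
have sX f : smooth (fun y => X y f) by exact: vfield_smooth.
have sY f : smooth (fun y => Y y f) by exact: vfield_smooth.
split=> [a f g sf sg|f g sf sg|f nf]; rewrite /lie.
- have lin W : vfield W -> (fun y => W y (fun y => a * f y + g y)) =
      (fun y => a * W y f + W y g).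
    by move=> vW; apply: funext => y; have [-> //] := vfield_tangent y vW.
  rewrite !lin//.
  have [-> // _ _] := tX; have [-> // _ _] := tY; ring.
- have prd W : vfield W -> (fun y => W y (fun y => f y * g y)) =
      (fun y => f y * W y g + g y * W y f).
    by move=> vW; apply: funext => y; have [_ -> //] := vfield_tangent y vW.
  rewrite !prd//.
  rewrite (tangentD tX (smoothM sf (sY g)) (smoothM sg (sY f))).
  rewrite (tangentD tY (smoothM sf (sX g)) (smoothM sg (sX f))).
  rewrite !(tangentM tX)// !(tangentM tY)//; ring.
- have z W : vfield W -> (fun y => W y f) = (fun=> 0).
    by move=> vW; apply: funext => y; have [_ _ -> //] := vfield_tangent y vW.
  by rewrite !z// (tangent_cst0 tX) (tangent_cst0 tY) subrr.
Qed.

Lemma lieC X Y : lie X Y = - lie Y X.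
Proof. by apply/funext => x; apply/funext => f; rewrite !fctE /lie opprB. Qed.

Lemma lieDl X X' Y : vfield X -> vfield X' -> vfield Y ->
  lie (X + X') Y = lie X Y + lie X' Y.
Proof.
move=> vX vX' vY; apply/funext => x; apply/funext => f.
rewrite !fctE /lie (tangentD (vfield_tangent x vY)); try exact: vfield_smooth.
by rewrite !fctE; ring.
Qed.

Lemma lieNl X Y : vfield X -> vfield Y -> lie (- X) Y = - lie X Y.
Proof.
move=> vX vY; apply/funext => x; apply/funext => f.
rewrite /lie.
have -> : (fun y => (- X) y f) = (fun y => -1 * X y f).
  by apply: funext => y; rewrite mulN1r.
rewrite (tangentZ _ (vfield_tangent x vY)); last exact: vfield_smooth.
by rewrite !fctE; ring.
Qed.

Lemma lieZl (a : R) X Y : vfield X -> vfield Y -> lie (a *: X) Y = a *: lie X Y.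
Proof.
move=> vX vY; apply/funext => x; apply/funext => f; rewrite !fctE /lie.
have -> : (fun y => (a *: X) y f) = (fun y => a * X y f) by [].
rewrite (tangentZ _ (vfield_tangent x vY)); last exact: vfield_smooth.
by rewrite /GRing.scale/= mulrBr.
Qed.

Lemma lieDr X Y Y' : vfield X -> vfield Y -> vfield Y' ->
  lie X (Y + Y') = lie X Y + lie X Y'.
Proof. by move=> vX vY vY'; rewrite lieC lieDl// opprD -!lieC. Qed.

Lemma lieNr X Y : vfield X -> vfield Y -> lie X (- Y) = - lie X Y.
Proof. by move=> vX vY; rewrite lieC lieNl// -lieC. Qed.

Lemma lieBl X X' Y : vfield X -> vfield X' -> vfield Y ->
  lie (X - X') Y = lie X Y - lie X' Y.
Proof. by move=> vX vX' vY; rewrite lieDl ?lieNl//; exact: vfieldN. Qed.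

Lemma lieBr X Y Y' : vfield X -> vfield Y -> vfield Y' ->
  lie X (Y - Y') = lie X Y - lie X Y'.
Proof. by move=> vX vY vY'; rewrite lieDr ?lieNr//; exact: vfieldN. Qed.

Lemma lie0l Y : vfield Y -> lie 0 Y = 0.
Proof.
move=> vY; have v0 := vfield_on0 (@openT M).
have := lieDl v0 v0 vY; rewrite addr0 => /(congr1 (fun Z => Z - lie 0 Y)).
by rewrite addrK subrr.
Qed.

Lemma lie_suml (I : Type) (r : seq I) (F : I -> field M) Y :
  (forall i, vfield (F i)) -> vfield Y ->
  lie (\sum_(i <- r) F i) Y = \sum_(i <- r) lie (F i) Y.
Proof.
move=> vF vY; have vS s : vfield (\sum_(i <- s) F i).
  elim: s => [|i s IHs]; first by rewrite big_nil; exact: vfield_on0 openT.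
  by rewrite big_cons; exact: vfieldD.
elim: r => [|i r IHr]; first by rewrite !big_nil lie0l.
by rewrite !big_cons lieDl ?IHr.
Qed.

Lemma lie_jacobi X Y Z : vfield X -> vfield Y -> vfield Z ->
  lie X (lie Y Z) = lie (lie X Y) Z + lie Y (lie X Z).
Proof.
move=> vX vY vZ; apply/funext => x; apply/funext => f; rewrite !fctE /lie.
have E W W1 W2 f1 f2 : vfield W -> vfield W1 -> vfield W2 ->
    W x (fun y => W1 y f1 - W2 y f2) =
    W x (fun y => W1 y f1) - W x (fun y => W2 y f2).
  move=> vW v1 v2; rewrite (tangentB (vfield_tangent x vW))//.
    exact: vfield_smooth.
  exact: vfield_smooth.
rewrite !E//.
by ring.
Qed.

(** The derivation property of the bracket in its first argument. *)
Lemma lie_fscale f X Y x : smooth f -> vfield X -> vfield Y ->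
  lie (fscale f X) Y x = f x *: lie X Y x - Y x f *: X x.
Proof.
move=> sf vX vY; apply/funext => g; rewrite !fctE /lie /fscale.
have -> : (fun y => (f y *: X y) g) = (fun y => f y * X y g) by [].
rewrite (tangentM (vfield_tangent x vY) sf); last exact: vfield_smooth.
rewrite -[(f x *: X x) _]/(f x * X x _) /GRing.scale/=; ring.
Qed.

End VectorFieldCalculus.

(** * Sections of subbundles *)

Section DualPoints.
Context (K : fieldType) (T : Type).

(** Linearly independent functions are separated by as many points.  The points
    are found one after the other: a nonzero combination of the [e_i] vanishes
    at those chosen so far, and a point where it does not vanish enlarges the
    rank. *)
Lemma dual_points r (e : 'I_r -> T -> K) :
  (forall a : 'I_r -> K, (forall t, \sum_i a i * e i t = 0) -> forall i, a i = 0) ->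
  exists g : 'I_r -> T, \det (\matrix_(i, j) e i (g j)) != 0.
Proof.
move=> ind.
have step s : (s <= r)%N ->
    exists g : 'I_s -> T, \rank (\matrix_(j < s, i < r) e i (g j)) = s.
  elim: s => [|s IHs] sr.
    have g0 : 'I_0 -> T by case.
    by exists g0; apply/eqP; rewrite -leqn0 rank_leq_row.
  have [g rg] := IHs (ltnW sr).
  set A := (\matrix_(_, _) _) in rg.
  have [v [v0 Av]] : exists v : 'rV[K]_r, v != 0 /\ A *m v^T = 0.
    have : kermx A^T != 0.
      by rewrite -mxrank_eq0 mxrank_ker mxrank_tr rg subn_eq0 -ltnNge.
    move=> /rowV0Pn[v /sub_kermxP vA v0]; exists v; split=> //.
    by rewrite -[A]trmxK -trmx_mul vA trmx0.
  have [t vt] : exists t, \sum_i v 0 i * e i t != 0.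
    apply: contrapT => nt; move/eqP: v0; apply.
    apply/rowP => i; rewrite mxE; apply: (ind (fun i => v 0 i)) => t.
    by apply: contrapT => /eqP vt; apply: nt; exists t.
  pose w : 'rV[K]_r := \row_i e i t.
  have nw : ~~ (w <= A)%MS.
    apply/negP => /submxP[b wb]; move/eqP: vt; apply.
    have : (w *m v^T) 0 0 = 0 by rewrite wb -mulmxA Av mulmx0 mxE.
    by rewrite mxE => w0; rewrite -[RHS]w0; apply: eq_bigr => i _; rewrite !mxE mulrC.
  pose g' (j : 'I_s.+1) := if unlift ord_max j is Some k then g k else t.
  exists g'; set A' := (\matrix_(_, _) _).
  have AA' : (A < A')%MS.
    have sAA' : (A <= A')%MS.
      apply/row_subP => k; have -> : row k A = row (lift ord_max k) A'.
        by apply/rowP => i; rewrite !mxE /g' liftK.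
      exact: row_sub.
    rewrite ltmxE sAA'; apply: contra nw; apply: submx_trans.
    have -> : w = row ord_max A'.
      by apply/rowP => i; rewrite !mxE /g' unlift_none.
    exact: row_sub.
  apply/eqP; rewrite eqn_leq rank_leq_row.
  by have := rank_ltmx AA'; rewrite rg.
have [g rg] := step r (leqnn r); exists g.
have -> : (\matrix_(i, j) e i (g j)) = (\matrix_(j < r, i < r) e i (g j))^T.
  by apply/matrixP => i j; rewrite !mxE.
rewrite det_tr -unitfE -unitmxE -row_full_unit /row_full rg eqxx //.
Qed.

End DualPoints.

Section Bases.
Context (K : fieldType) (V : lmodType K) (r : nat).

Lemma is_basis_lin (E : set V) (e : 'I_r -> V) (a : K) u v :
  is_basis E e -> E u -> E v -> E (a *: u + v).
Proof.
move=> [spanE _] /spanE[b ->] /spanE[c ->]; apply/spanE.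
exists (fun i => a * b i + c i); rewrite scaler_sumr -big_split/=.
by apply: eq_bigr => i _; rewrite scalerDl scalerA.
Qed.

Lemma is_basis0 (E : set V) (e : 'I_r -> V) : is_basis E e -> E 0.
Proof.
move=> [spanE _]; apply/spanE; exists (fun=> 0).
by rewrite big1// => i _; rewrite scale0r.
Qed.

End Bases.

Section Distributions.
Context (R : realType) (n : nat) (M : manifold R n).
Implicit Types (X Y : field M) (E : M -> set (Tvec M)).

Definition subbundle E : Prop := exists r, real_distribution r E.

Section OneDistribution.
Variable E : M -> set (Tvec M).
Hypothesis distrE : subbundle E.

Lemma distr_lin x (a : R) u v : E x u -> E x v -> E x (a *: u + v).
Proof.
have [r rE] := distrE.
by have [U [e [_ Ux _ /(_ x Ux)]]] := rE x; exact: is_basis_lin.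
Qed.

Lemma distr0 x : E x 0.
Proof.
have [r rE] := distrE.
by have [U [e [_ Ux _ /(_ x Ux)]]] := rE x; exact: is_basis0.
Qed.

Lemma sections_lin (a : R) X Y :
  sections E X -> sections E Y -> sections E (a *: X + Y).
Proof.
move=> [vX EX] [vY EY]; split; first exact: vfield_lin.
by move=> x; exact: distr_lin.
Qed.

Lemma distr_section x v : E x v -> exists2 X, sections E X & X x = v.
Proof.
move=> Ev; have [r rE] := distrE; have [U [e [oU Ux ve be]]] := rE x.
have [phi [V [sphi phix] [oV UV phi0]]] := bump oU Ux.
have [a av] := ((be x Ux).1 v).1 Ev.
exists (fscale phi (\sum_i a i *: e i)); last first.
  by rewrite /fscale phix scale1r av fct_sumE.
split.
  by apply: (cutoff_vfield oU oV UV sphi phi0); apply: vfield_on_sum.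
move=> y; have : (U `|` V) y by rewrite UV.
move=> [Uy|/phi0 phiy]; last by rewrite /fscale phiy scale0r; exact: distr0.
rewrite -[fscale _ _ _]addr0; apply: distr_lin; last exact: distr0.
by rewrite fct_sumE; apply/((be y Uy).1 _); exists a.
Qed.

Lemma sections0 : sections E 0.
Proof. by split=> [|x]; [exact: vfield_on0 openT|exact: distr0]. Qed.

Lemma sectionsD X Y : sections E X -> sections E Y -> sections E (X + Y).
Proof. by rewrite -[X in sections _ (X + _)]scale1r; exact: sections_lin. Qed.

Lemma sectionsN X : sections E X -> sections E (- X).
Proof.
move=> sX; rewrite -[- X]addr0 -scaleN1r.
by apply: sections_lin => //; exact: sections0.
Qed.

Lemma sectionsB X Y : sections E X -> sections E Y -> sections E (X - Y).
Proof. by move=> sX /sectionsN; exact: sectionsD. Qed.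

Lemma distrD x u v : E x u -> E x v -> E x (u + v).
Proof. by rewrite -[X in E x (X + _)]scale1r; exact: distr_lin. Qed.

Lemma distrN x u : E x u -> E x (- u).
Proof.
by move=> Eu; rewrite -[- u]addr0 -scaleN1r; apply: distr_lin => //; exact: distr0.
Qed.

Lemma distrB x u v : E x u -> E x v -> E x (u - v).
Proof. by move=> Eu /distrN; exact: distrD. Qed.

Lemma distrZ x (a : R) u : E x u -> E x (a *: u).
Proof. by move=> Eu; rewrite -[_ *: _]addr0; apply: distr_lin => //; exact: distr0. Qed.

Lemma distr_tangent x v : E x v -> tangent x v.
Proof. by move=> /distr_section[X [vX _] <-]; exact: vfield_tangent. Qed.

(** Hadamard's lemma for sections.  In a frame [e_i], Cramer's rule for the
    matrix of the functions [e_i g_j], where the [g_j] make its determinant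
    [d] nonzero at [x], gives [d X] as a combination of the [e_i] with smooth
    coefficients that vanish wherever [X] does. *)
Lemma section_hadamard X x : sections E X -> X x = 0 ->
  exists (N : nat) (b : 'I_N -> M -> R) (s : 'I_N -> field M),
    [/\ forall i, smooth (b i), forall i, b i x = 0,
        forall i, sections E (s i) & X = \sum_i fscale (b i) (s i)].
Proof.
move=> sX X0; have [vX EX] := sX.
have [r rE] := distrE; have [U [e [oU Ux ve be]]] := rE x.
have [phi [V [sphi phix] [oV UV phi0]]] := bump oU Ux.
have [g detg] : exists g, \det (\matrix_(i, j) e i x (g j)) != 0.
  apply: (@dual_points R (M -> R) r (fun i => e i x)) => a a0.
  apply: (be x Ux).2.
  by apply: funext => f; rewrite fct_sumE -[RHS](a0 f).
pose A (y : M) := \matrix_(i, j) e i y (g j).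
have sA i j : smooth_on U (fun y => A y i j).
  apply: (@smooth_on_eq _ _ _ _ (fun y => e i y (g j))) => //.
    by move=> y _; rewrite mxE.
  exact: vfield_on_smooth.
pose al i (y : M) := \sum_j X y (g j) * (\adj (A y)) j i.
have alE y : U y -> \det (A y) *: X y = \sum_i al i y *: e i y.
  move=> Uy; have [a aE] := ((be y Uy).1 (X y)).1 (EX y).
  rewrite {1}aE scaler_sumr; apply: eq_bigr => i _; rewrite scalerA.
  congr (_ *: _).
  have := congr1 (fun B : 'rV_r => B 0 i)
    (mulmxA (\row_k a k) (A y) (\adj (A y))).
  rewrite mul_mx_adj mul_mx_scalar !mxE => ->; apply: eq_bigr => j _.
  congr (_ * _); rewrite mxE aE fct_sumE.
  by apply: eq_bigr => k _; rewrite !mxE.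
have sal i : smooth_on U (al i).
  apply: smooth_on_sum => // j; apply: smooth_onM => //.
    by apply: vfield_on_smooth => //; exact: vfield_on_sub.
  by apply: smooth_on_adj => // k l; exact: sA.
have sd : smooth_on U (fun y => \det (A y)) by exact: smooth_on_det.
have cut f : smooth_on U f -> smooth (fun y => phi y * f y).
  move=> sf; rewrite /smooth -UV; apply: smooth_on_union.
    by apply: smooth_onM => //; exact: smooth_on_smooth.
  apply: (@smooth_on_eq _ _ _ _ (fun=> 0)) => //; last exact: smooth_on_cst.
  by move=> y Vy; rewrite phi0// mul0r.
pose c := (\det (A x))^-1.
have c0 : c * \det (A x) = 1 by rewrite mulVf.
(* With a bump function [phi] and [c = 1 / d(x)], the field [X] is the sum of
   [c phi^2 d X], which is expressed in the frame, and of its multiple by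
   [1 - c phi^2 d], which vanishes at [x]; the last index is for the latter. *)
pose b (j : 'I_r.+1) : M -> R := if unlift ord_max j is Some i
  then fun y => phi y * al i y
  else fun y => 1 - c * (phi y * (phi y * \det (A y))).
pose s (j : 'I_r.+1) : field M := if unlift ord_max j is Some i
  then fscale (fun y => c * phi y) (e i) else X.
exists r.+1, b, s; split.
- move=> j; rewrite /b; case: unliftP => [i|] _; first exact: cut.
  apply: smoothB; first exact: smooth_cst.
  by apply: smoothZ; apply: smoothM => //; exact: cut.
- move=> j; rewrite /b; case: unliftP => [i|] _.
    by rewrite /al big1 ?mulr0// => k _; rewrite X0 mul0r.
  by rewrite phix !mul1r c0 subrr.
- move=> j; rewrite /s; case: unliftP => [i|] _ //.
  have scphi : smooth (fun y => c * phi y) by exact: smoothZ.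
  split.
    apply: (cutoff_vfield oU oV UV scphi) => // y Vy.
    by rewrite phi0// mulr0.
  move=> y; have : (U `|` V) y by rewrite UV.
  move=> [Uy|/phi0 phiy]; last first.
    by rewrite /fscale phiy mulr0 scale0r; exact: distr0.
  rewrite -[fscale _ _ _]addr0; apply: distr_lin; last exact: distr0.
  apply/((be y Uy).1 _); exists (fun k => (k == i)%:R).
  rewrite (bigD1 i)//= eqxx scale1r big1 ?addr0// => k /negbTE ->.
  by rewrite scale0r.
- apply: funext => y; rewrite fct_sumE big_ord_recr/=.
  rewrite {2}/fscale /b /s unlift_none /=.
  under eq_bigr => i _.
    have -> : widen_ord (leqnSn r) i = lift ord_max i.
      by apply: val_inj; exact: esym (lift_max i).
    rewrite liftK /fscale scalerA -[X in X *: _]mulrA [al i y * _]mulrC mulrA.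
    rewrite -scalerA.
    over.
  rewrite -scaler_sumr.
  have : (U `|` V) y by rewrite UV.
  move=> [Uy|/phi0 phiy].
    rewrite -alE// scalerA -scalerDl -[LHS]scale1r; congr (_ *: _); ring.
  by rewrite phiy !(mul0r, mulr0) subr0 scale0r add0r scale1r.
Qed.

End OneDistribution.
End Distributions.

(** * Complex vector fields *)

Section ComplexSums.
Context (V : zmodType) (I : Type) (r : seq I) (P : pred I).

Lemma fst_sum (F : I -> cplx V) :
  (\sum_(i <- r | P i) F i).1 = \sum_(i <- r | P i) (F i).1.
Proof. exact: (big_morph (fun z : cplx V => z.1)). Qed.

Lemma snd_sum (F : I -> cplx V) :
  (\sum_(i <- r | P i) F i).2 = \sum_(i <- r | P i) (F i).2.
Proof. exact: (big_morph (fun z : cplx V => z.2)). Qed.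

End ComplexSums.

Section ComplexFields.
Context (R : realType) (n : nat) (M : manifold R n).
Implicit Types (X Y Z W : cplx (field M)).

Definition cvfield X : Prop := vfield X.1 /\ vfield X.2.

Lemma cvfieldD X Y : cvfield X -> cvfield Y -> cvfield (X + Y).
Proof. by move=> [? ?] [? ?]; split; exact: vfieldD. Qed.

Lemma cvfieldN X : cvfield X -> cvfield (- X).
Proof. by move=> [? ?]; split; exact: vfieldN. Qed.

Lemma cvfield_conj X : cvfield X -> cvfield (cconj X).
Proof. by move=> [? ?]; split=> //; exact: vfieldN. Qed.

Lemma clie_cvfield X Y : cvfield X -> cvfield Y -> cvfield (clie X Y).
Proof.
move=> [? ?] [? ?]; split; [apply: vfieldB|apply: vfieldD]; exact: lie_vfield.
Qed.

Lemma cevalD x X Y : ceval x (X + Y) = ceval x X + ceval x Y.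
Proof. by []. Qed.

Lemma cevalN x X : ceval x (- X) = - ceval x X.
Proof. by []. Qed.

Lemma cevalB x X Y : ceval x (X - Y) = ceval x X - ceval x Y.
Proof. by []. Qed.

Lemma clieC X Y : clie X Y = - clie Y X.
Proof.
congr pair.
  by rewrite /= opprB [lie X.1 _]lieC [lie X.2 _]lieC opprK addrC.
by rewrite /= opprD [lie X.1 _]lieC [lie X.2 _]lieC addrC.
Qed.

Lemma clieDl X X' Y : cvfield X -> cvfield X' -> cvfield Y ->
  clie (X + X') Y = clie X Y + clie X' Y.
Proof.
move=> [? ?] [? ?] [? ?]; congr pair; rewrite /= !lieDl// ?opprD addrACA//.
Qed.

Lemma clieDr X Y Y' : cvfield X -> cvfield Y -> cvfield Y' ->
  clie X (Y + Y') = clie X Y + clie X Y'.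
Proof. by move=> vX vY vY'; rewrite clieC clieDl// opprD -!clieC. Qed.

Lemma cvfieldZ (a : R[i]) X : cvfield X -> cvfield (a *: X).
Proof.
by move=> [? ?]; split; [apply: vfieldB|apply: vfieldD]; exact: vfieldZ.
Qed.

Lemma clieZl (a : R[i]) X Y : cvfield X -> cvfield Y ->
  clie (a *: X) Y = a *: clie X Y.
Proof.
case: a X Y => [a b] [X1 X2] [Y1 Y2] [/= vX1 vX2] [/= vY1 vY2].
congr pair; rewrite /= lieBl ?lieDl ?lieZl//; try exact: vfieldZ.
  move: (lie X1 Y1) (lie X1 Y2) (lie X2 Y1) (lie X2 Y2) => p q r s.
  rewrite scalerBr scalerDr !opprD addrACA.
  by congr (_ + _); exact: addrC.
move: (lie X1 Y1) (lie X1 Y2) (lie X2 Y1) (lie X2 Y2) => p q r s.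
rewrite scalerBr scalerDr addrACA.
by congr (_ + _); exact: addrC.
Qed.

Lemma clieZr (a : R[i]) X Y : cvfield X -> cvfield Y ->
  clie X (a *: Y) = a *: clie X Y.
Proof. by move=> vX vY; rewrite clieC clieZl// -scalerN -clieC. Qed.

Lemma clieNl X Y : cvfield X -> cvfield Y -> clie (- X) Y = - clie X Y.
Proof.
move=> [? ?] [? ?]; congr pair; rewrite /= !lieNl//.
  by rewrite opprB opprK addrC.
by rewrite [RHS]opprD.
Qed.

Lemma clieNr X Y : cvfield X -> cvfield Y -> clie X (- Y) = - clie X Y.
Proof. by move=> vX vY; rewrite clieC clieNl// -clieC. Qed.

Lemma clieBl X X' Y : cvfield X -> cvfield X' -> cvfield Y ->
  clie (X - X') Y = clie X Y - clie X' Y.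
Proof. by move=> vX vX' vY; rewrite clieDl ?clieNl//; exact: cvfieldN. Qed.

Lemma clieBr X Y Y' : cvfield X -> cvfield Y -> cvfield Y' ->
  clie X (Y - Y') = clie X Y - clie X Y'.
Proof. by move=> vX vY vY'; rewrite clieDr ?clieNr//; exact: cvfieldN. Qed.

Lemma clie_conj X Y : cvfield X -> cvfield Y ->
  clie (cconj X) (cconj Y) = cconj (clie X Y).
Proof.
move=> [? ?] [? ?]; congr pair; rewrite /= ?lieNl ?lieNr//; try exact: vfieldN.
  by rewrite opprK.
by rewrite [RHS]opprD.
Qed.

(** The bracket is abstract because only its bilinearity and the Jacobi identity
    on vector fields enter. *)
Lemma cbil_jacobi (br : field M -> field M -> field M) X Y Z :
  (forall A B, vfield A -> vfield B -> vfield (br A B)) ->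
  (forall A B C, vfield A -> vfield B -> vfield C ->
    br (A + B) C = br A C + br B C) ->
  (forall A B C, vfield A -> vfield B -> vfield C ->
    br A (B + C) = br A B + br A C) ->
  (forall A B C, vfield A -> vfield B -> vfield C ->
    br (A - B) C = br A C - br B C) ->
  (forall A B C, vfield A -> vfield B -> vfield C ->
    br A (B - C) = br A B - br A C) ->
  (forall A B C, vfield A -> vfield B -> vfield C ->
    br A (br B C) = br (br A B) C + br B (br A C)) ->
  cvfield X -> cvfield Y -> cvfield Z ->
  cbil br X (cbil br Y Z) = cbil br (cbil br X Y) Z + cbil br Y (cbil br X Z).
Proof.
move=> vbr brDl brDr brBl brBr jac.
case: X Y Z => [X1 X2] [Y1 Y2] [Z1 Z2] [/= vX1 vX2] [/= vY1 vY2] [/= vZ1 vZ2].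
congr pair; rewrite /= ?brBr ?brBl ?brDr ?brDl //; try exact: vbr.
- rewrite !(jac X1) // !(jac X2) //.
  by apply/funext => x; apply/funext => f; rewrite !fctE; ring.
- rewrite !(jac X1) // !(jac X2) //.
  by apply/funext => x; apply/funext => f; rewrite !fctE; ring.
Qed.

Lemma clie_jacobi X Y Z : cvfield X -> cvfield Y -> cvfield Z ->
  clie X (clie Y Z) = clie (clie X Y) Z + clie Y (clie X Z).
Proof.
apply: cbil_jacobi => A B.
- exact: lie_vfield.
- exact: lieDl.
- exact: lieDr.
- exact: lieBl.
- exact: lieBr.
- exact: lie_jacobi.
Qed.

(** At a zero of [X], the derivation property of the bracket leaves only the
    terms that differentiate the coefficients of [X]. *)
Lemma clie_at_zero X Y x N (b : 'I_N -> M -> R) (s t : 'I_N -> field M) :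
  (forall i, smooth (b i)) -> (forall i, b i x = 0) ->
  (forall i, vfield (s i)) -> (forall i, vfield (t i)) -> cvfield Y ->
  X = (\sum_i fscale (b i) (s i), \sum_i fscale (b i) (t i)) ->
  ceval x (clie X Y) =
  - \sum_i (Y.1 x (b i) +i* Y.2 x (b i))%C *: ceval x (s i, t i).
Proof.
move=> sb b0 vs vt [vY1 vY2] ->.
have E (u : 'I_N -> field M) (W : field M) : (forall i, vfield (u i)) -> vfield W ->
    lie (\sum_i fscale (b i) (u i)) W x = - \sum_i W x (b i) *: u i x.
  move=> vu vW; rewrite lie_suml//; last by move=> i; exact: fscale_vfield.
  rewrite fct_sumE -sumrN; apply: eq_bigr => i _.
  by rewrite lie_fscale// b0 scale0r sub0r.
rewrite [RHS]surjective_pairing /= fst_sum snd_sum /=; congr pair.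
  rewrite -[LHS]/(lie (\sum_i fscale (b i) (s i)) Y.1 x -
                  lie (\sum_i fscale (b i) (t i)) Y.2 x).
  by rewrite !E// opprK addrC -opprB -sumrB.
rewrite -[LHS]/(lie (\sum_i fscale (b i) (s i)) Y.2 x +
                lie (\sum_i fscale (b i) (t i)) Y.1 x).
by rewrite !E// -opprD addrC -big_split.
Qed.

End ComplexFields.

(** * Vectors of type (1,0) and (0,1) *)

Section AdditiveSubgroups.
Context (V : zmodType).
Implicit Types (A B : set V) (u v : V).

Definition zmodset A : Prop := A 0 /\ forall u v, A u -> A v -> A (u - v).

Lemma zmodsetN A u : zmodset A -> A u -> A (- u).
Proof. by move=> [A0 AB] Au; rewrite -sub0r; exact: AB. Qed.

Lemma zmodsetD A u v : zmodset A -> A u -> A v -> A (u + v).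
Proof. by move=> zA Au Av; rewrite -[v]opprK; apply: zA.2 => //; exact: zmodsetN. Qed.

Lemma zmodset_setsum A B : zmodset A -> zmodset B -> zmodset (setsum A B).
Proof.
move=> [A0 AB] [B0 BB]; split.
  by exists 0, 0; rewrite addr0.
move=> _ _ [a [b [Aa Bb ->]]] [a' [b' [Aa' Bb' ->]]].
exists (a - a'), (b - b'); split; [exact: AB|exact: BB|].
by rewrite opprD addrACA.
Qed.

Lemma setsuml A B u : zmodset B -> A u -> setsum A B u.
Proof. by move=> [B0 _] Au; exists u, 0; rewrite addr0. Qed.

Lemma setsumr A B u : zmodset A -> B u -> setsum A B u.
Proof. by move=> [A0 _] Bu; exists 0, u; rewrite add0r. Qed.

End AdditiveSubgroups.

Lemma halfD (K : numFieldType) (V : lmodType K) (v : V) :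
  2^-1 *: v + 2^-1 *: v = v.
Proof.
have e : 2^-1 + 2^-1 = 1 :> K by rewrite [RHS](splitr 1) mul1r.
by rewrite -scalerDl e scale1r.
Qed.

Section AlmostComplex.
Context (R : realType) (n : nat) (M : manifold R n) (S : CR_structure M).
Implicit Types (X Y : field M) (v w : Tvec M) (Z W : cplx (field M)).
Local Notation D := (crD S).
Local Notation J := (crJ S).

Lemma crD_subbundle : subbundle D.
Proof. by have [r rD] := crD_distr S; exists r.*2. Qed.

Let bD := crD_subbundle.

Lemma crJD x v w : D x v -> D x w -> J x (v + w) = J x v + J x w.
Proof.
by move=> Dv Dw; have := crJ_linear 1 Dv Dw; rewrite !scale1r.
Qed.

Lemma crJ0 x : J x 0 = 0.
Proof.
have D0 := distr0 bD x; have := crJD D0 D0; rewrite addr0.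
by move=> /(congr1 (fun u => u - J x 0)); rewrite addrK subrr.
Qed.

Lemma crJZ x (a : R) v : D x v -> J x (a *: v) = a *: J x v.
Proof.
move=> Dv; have := crJ_linear a Dv (distr0 bD x).
by rewrite crJ0 !addr0.
Qed.

Lemma crJN x v : D x v -> J x (- v) = - J x v.
Proof. by move=> Dv; rewrite -scaleN1r crJZ// scaleN1r. Qed.

Lemma crJB x v w : D x v -> D x w -> J x (v - w) = J x v - J x w.
Proof. by move=> Dv Dw; rewrite crJD ?crJN//; exact: distrN. Qed.

Lemma D10P x (z : cplx (Tvec M)) :
  D10 S x z <-> D x z.1 /\ z.2 = - J x z.1.
Proof.
case: z => u v; split=> /=.
  move=> [/= Du Dv [e1 e2]]; split=> //; move: e1.
  by rewrite scale0r scale1r sub0r => ->; rewrite opprK.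
move=> [Du ->]; split=> //=; first exact: (distrN bD (crJ_crD Du)).
  congr pair; rewrite /= scale0r scale1r; first by rewrite sub0r opprK.
rewrite add0r crJN ?crJ_sqr ?opprK//; exact: crJ_crD.
Qed.

Lemma D01P x (z : cplx (Tvec M)) :
  D01 S x z <-> D x z.1 /\ z.2 = J x z.1.
Proof.
split=> [[w /D10P[Dw w2] <-]|[Dz z2]]; first by rewrite /= w2 opprK.
exists (cconj z); last by case: z {Dz z2} => u v; rewrite /cconj/= opprK.
by apply/D10P => /=; rewrite z2.
Qed.

Definition Jfield X : field M := fun x => J x (X x).

Lemma Jfield_sections X : sections D X -> sections D (Jfield X).
Proof.
move=> sX; split; first exact: crJ_smooth.
by move=> x; apply: crJ_crD; exact: sX.2.
Qed.

Lemma csections10P Z :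
  csections (D10 S) Z <-> sections D Z.1 /\ Z.2 = - Jfield Z.1.
Proof.
split=> [[v1 v2 DZ]|[sZ Z2]].
  split; first by split=> // x; have /D10P[] := DZ x.
  by apply/funext => x; have /D10P[_] := DZ x.
split; first by exact: sZ.1.
  by rewrite Z2; apply: vfieldN; exact: (Jfield_sections sZ).1.
by move=> x; apply/D10P; split; [exact: sZ.2|rewrite /= Z2].
Qed.

Lemma csections01P Z :
  csections (D01 S) Z <-> sections D Z.1 /\ Z.2 = Jfield Z.1.
Proof.
split=> [[v1 v2 DZ]|[sZ Z2]].
  split; first by split=> // x; have /D01P[] := DZ x.
  by apply/funext => x; have /D01P[_] := DZ x.
split; first by exact: sZ.1.
  by rewrite Z2; exact: (Jfield_sections sZ).1.
by move=> x; apply/D01P; split; [exact: sZ.2|rewrite /= Z2].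
Qed.

Definition hol X : cplx (field M) := (X, - Jfield X).
Definition ahol X : cplx (field M) := (X, Jfield X).

Lemma hol_csections X : sections D X -> csections (D10 S) (hol X).
Proof. by move=> sX; exact/csections10P. Qed.

Lemma ahol_csections X : sections D X -> csections (D01 S) (ahol X).
Proof. by move=> sX; exact/csections01P. Qed.

Lemma cconjK (V : zmodType) : involutive (@cconj V).
Proof. by case=> u v; rewrite /cconj/= opprK. Qed.

Lemma csections_conj Z : csections (D10 S) Z <-> csections (D01 S) (cconj Z).
Proof.
split=> [/csections10P[sZ Z2]|/csections01P[/= sZ Z2]].
  by apply/csections01P; split=> //=; rewrite Z2 opprK.
by apply/csections10P; split=> //=; rewrite -Z2 opprK.
Qed.

Lemma csections_cvfield E Z : csections E Z -> cvfield Z.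
Proof. by case. Qed.

(** Sections of the complexification of [D]. *)
Definition Dcplx Z : Prop := sections D Z.1 /\ sections D Z.2.

Lemma csections10_Dcplx Z : csections (D10 S) Z -> Dcplx Z.
Proof.
move=> /csections10P[sZ Z2]; split; rewrite ?Z2//.
exact: (sectionsN bD (Jfield_sections sZ)).
Qed.

Lemma csections01_Dcplx Z : csections (D01 S) Z -> Dcplx Z.
Proof.
move=> /csections01P[sZ Z2]; split; rewrite ?Z2//; exact: Jfield_sections.
Qed.

Lemma clie01 Z W : csections (D01 S) Z -> csections (D01 S) W ->
  csections (D01 S) (clie Z W).
Proof.
move=> sZ sW; rewrite -[Z]cconjK -[W]cconjK clie_conj.
- by apply/csections_conj/cr_involutive; apply/csections_conj; rewrite cconjK.
- exact/cvfield_conj/csections_cvfield/sZ.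
- exact/cvfield_conj/csections_cvfield/sW.
Qed.

Lemma csections01_zmod : zmodset (csections (D01 S)).
Proof.
split.
  apply/csections01P; split; first exact: sections0.
  by apply/funext => x; rewrite /= /Jfield crJ0.
move=> Z W /csections01P[sZ Z2] /csections01P[sW W2]; apply/csections01P; split.
  exact: sectionsB.
apply/funext => x; rewrite /= Z2 W2; symmetry.
by apply: crJB; [exact: sZ.2|exact: sW.2].
Qed.

Lemma D01_lin x (a : R[i]) (z w : cplx (Tvec M)) :
  D01 S x z -> D01 S x w -> D01 S x (a *: z + w).
Proof.
move=> /D01P[Dz z2] /D01P[Dw w2]; apply/D01P.
have JDz := crJ_crD Dz; case: a => a b /=; rewrite z2 w2.
have Da := distrB bD (distrZ bD a Dz) (distrZ bD b JDz).
split; first exact: distrD.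
rewrite crJD// crJB ?crJZ ?crJ_sqr//; [|exact: distrZ..].
by rewrite scalerN opprK.
Qed.

Lemma D01_zmod x : zmodset (D01 S x).
Proof.
split.
  by apply/D01P; split; [exact: distr0|rewrite /= crJ0].
move=> z w Dz Dw; rewrite addrC -scaleN1r; exact: D01_lin.
Qed.

(** Involutivity in real form: these are the real and imaginary parts of
    [[X + iJX, Y + iJY]]. *)
Lemma lie_Jfield X Y : sections D X -> sections D Y ->
  sections D (lie X Y - lie (Jfield X) (Jfield Y)) /\
  sections D (lie X (Jfield Y) + lie (Jfield X) Y).
Proof.
move=> sX sY; have := clie01 (ahol_csections sX) (ahol_csections sY).
by move=> /csections01_Dcplx.
Qed.

(** The component of type (1,0) of [z] is [(z - iJz)/2]. *)
Lemma D10D01_split x (z : cplx (Tvec M)) : D x z.1 -> D x z.2 ->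
  setsum (D10 S x) (D01 S x) z.
Proof.
move=> D1 D2; pose a := 2^-1 *: (z.1 + J x z.2); pose b := 2^-1 *: (z.1 - J x z.2).
have JD2 := crJ_crD D2; have JD1 := crJ_crD D1.
have Ds := distrD bD D1 JD2; have Db := distrB bD D1 JD2.
exists (a, - J x a), (b, J x b); split.
- by apply/D10P; split=> //=; exact: distrZ.
- by apply/D01P; split=> //=; exact: distrZ.
- rewrite [LHS]surjective_pairing; congr pair => /=; rewrite /a /b.
    by rewrite -scalerDr addrACA subrr addr0 scalerDr halfD.
  rewrite !crJZ// crJD// crJB// !crJ_sqr// -scalerN -scalerDr.
  by rewrite opprB opprK addrA subrK scalerDr halfD.
Qed.

Lemma D10D01_disjoint x (z : cplx (Tvec M)) : D10 S x z -> D01 S x z -> z = 0.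
Proof.
move=> /D10P[Dz z2] /D01P[_ z2'].
have z20 : z.2 = 0.
  have : z.2 *+ 2 = 0 by rewrite mulr2n {1}z2 z2' addNr.
  by rewrite -scaler_nat => /eqP; rewrite scaler_eq0 pnatr_eq0 => /eqP.
have z10 : z.1 = 0 by rewrite -[z.1]opprK -(crJ_sqr Dz) -z2' z20 crJ0 oppr0.
by rewrite [z]surjective_pairing z10 z20.
Qed.

End AlmostComplex.

(** * The Freeman bundles and their real forms *)

Section ComplexBundles.
Context (R : realType) (n : nat) (M : manifold R n).
Variables (r : nat) (E : M -> set (cplx (Tvec M))).
Hypothesis bE : complex_distribution r E.
Implicit Types (Z W : cplx (field M)) (z w : cplx (Tvec M)).

Lemma cdistr_lin x (a : R[i]) z w : E x z -> E x w -> E x (a *: z + w).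
Proof. by have [U [e [_ Ux _ /(_ x Ux)]]] := bE x; exact: is_basis_lin. Qed.

Lemma cdistr0 x : E x 0.
Proof. by have [U [e [_ Ux _ /(_ x Ux)]]] := bE x; exact: is_basis0. Qed.

Lemma cdistr_zmod x : zmodset (E x).
Proof.
split=> [|z w Ez Ew]; first exact: cdistr0.
by rewrite addrC -scaleN1r; exact: cdistr_lin.
Qed.

Lemma csections_zmod : zmodset (csections E).
Proof.
split.
  by split; [exact: vfield_on0 openT..|move=> x; exact: cdistr0].
move=> Z W [vZ1 vZ2 EZ] [vW1 vW2 EW]; split; [exact: vfieldB..|move=> x].
exact: ((cdistr_zmod x).2 _ _ (EZ x) (EW x)).
Qed.

(** As for real subbundles: extend the coefficients in a frame as constants and
    cut off. *)
Lemma cdistr_section x z : E x z -> exists2 Z, csections E Z & ceval x Z = z.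
Proof.
move=> Ez; have [U [e [oU Ux ve be]]] := bE x.
have [phi [V [sphi phix] [oV UV phi0]]] := bump oU Ux.
have [a az] := ((be x Ux).1 z).1 Ez.
pose Z1 : field M := \sum_i (complex.Re (a i) *: (e i).1 - complex.Im (a i) *: (e i).2).
pose Z2 : field M := \sum_i (complex.Re (a i) *: (e i).2 + complex.Im (a i) *: (e i).1).
have ZE y : (Z1 y, Z2 y) = \sum_i a i *: ceval y (e i).
  rewrite [RHS]surjective_pairing fst_sum snd_sum /Z1 /Z2 !fct_sumE.
  by congr pair; apply: eq_bigr => i _; case: (a i).
have vre (b c : 'I_r -> R) : vfield_on U (\sum_i (b i *: (e i).1 + c i *: (e i).2)).
  rewrite big_split/=; rewrite -[X in X + _]scale1r.
  by apply: vfield_on_lin => //; apply: vfield_on_sum => // i; case: (ve i).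
exists (fscale phi Z1, fscale phi Z2); last first.
  by rewrite /ceval/cmap/= /fscale phix !scale1r ZE.
split.
- apply: (cutoff_vfield oU oV UV sphi phi0).
  rewrite /Z1; under eq_bigr do rewrite -scaleNr.
  exact: vre.
- apply: (cutoff_vfield oU oV UV sphi phi0).
  rewrite /Z2; under eq_bigr do rewrite addrC.
  exact: vre.
- move=> y; have : (U `|` V) y by rewrite UV.
  rewrite /ceval/cmap/= /fscale; move=> [Uy|/phi0 ->]; last first.
    by rewrite !scale0r; exact: cdistr0.
  have -> : (phi y *: Z1 y, phi y *: Z2 y) =
      (phi y)%:C%C *: ((Z1 y, Z2 y) : cplx (Tvec M)) + 0.
    by rewrite addr0; congr pair; rewrite /= scale0r ?subr0 ?addr0.
  apply: cdistr_lin; last exact: cdistr0.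
  by rewrite ZE; apply/((be y Uy).1 _); exists a.
Qed.

End ComplexBundles.

Section Freeman.
Context (R : realType) (n : nat) (M : manifold R n) (S : CR_structure M).
Variable C : regular_CR S.
Implicit Types (X Y : field M) (v w : Tvec M) (Z W : cplx (field M)).
Local Notation D := (crD S).
Local Notation J := (crJ S).
Local Notation bD := (crD_subbundle S).

Lemma freeman_nat_lin j x (a : R[i]) (z w : cplx (Tvec M)) :
  freeman_nat C j x z -> freeman_nat C j x w -> freeman_nat C j x (a *: z + w).
Proof. by have [r bE] := freeman_distr C j; exact: (cdistr_lin bE). Qed.

Lemma freeman_nat_zmod j x : zmodset (freeman_nat C j x).
Proof. by have [r bE] := freeman_distr C j; exact: (cdistr_zmod bE). Qed.

Lemma freeman_mod_zmod j : zmodset (freeman_mod S j).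
Proof.
have [r bE] := freeman_distr C j; rewrite (freeman_sections C).
exact: (csections_zmod bE).
Qed.

Lemma freeman_modE j Z x : freeman_mod S j Z -> freeman_nat C j x (ceval x Z).
Proof. by rewrite (freeman_sections C) => -[]. Qed.

Lemma freeman_extend j x z : freeman_nat C j x z ->
  exists2 Z, freeman_mod S j Z & ceval x Z = z.
Proof.
have [r bE] := freeman_distr C j; rewrite (freeman_sections C).
exact: (cdistr_section bE).
Qed.

Lemma freeman_nat_mono j x z : freeman_nat C j.+1 x z -> freeman_nat C j x z.
Proof. by move=> /freeman_extend[Z [FZ _] <-]; exact: freeman_modE. Qed.

Lemma freeman_mod_D10 j Z : freeman_mod S j Z -> csections (D10 S) Z.
Proof. by elim: j => [//|j IHj] [/IHj]. Qed.

Lemma freeman_nat_D10 j x z : freeman_nat C j x z -> D10 S x z.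
Proof.
by move=> /freeman_extend[Z /freeman_mod_D10[_ _ DZ] <-]; exact: DZ.
Qed.

Lemma freeman_nat0 x z : freeman_nat C 0 x z <-> D10 S x z.
Proof.
split=> [|/D10P[Dz z2]]; first exact: freeman_nat_D10.
have [X sX Xx] := distr_section bD Dz.
have := freeman_modE (j := 0) x (hol_csections sX).
rewrite /ceval/cmap/= -[(- Jfield S X) x]/(- J x (X x)) Xx -z2.
by rewrite -surjective_pairing.
Qed.

(** The real subbundle [Re F_(j-1)], through the isomorphism [v |-> v - iJv]. *)
Definition freeR (j : nat) (x : M) : set (Tvec M) :=
  [set v | freeman_nat C j x (v, - J x v)].

Lemma freeRP j x z :
  freeman_nat C j x z <-> freeR j x z.1 /\ z.2 = - J x z.1.
Proof.
rewrite /freeR /=; split=> [Fz|[Fz z2]]; last by rewrite [z]surjective_pairing z2.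
have /D10P[_ z2] := freeman_nat_D10 Fz.
by split=> //; rewrite -z2 -surjective_pairing.
Qed.

Lemma freeR_D j x v : freeR j x v -> D x v.
Proof. by move=> /freeman_nat_D10/D10P[]. Qed.

Lemma freeR0 x v : freeR 0 x v <-> D x v.
Proof.
split=> [|Dv]; first exact: freeR_D.
by apply/freeman_nat0/D10P.
Qed.

Lemma freeR_mono j x v : freeR j.+1 x v -> freeR j x v.
Proof. exact: freeman_nat_mono. Qed.

(** Multiply [v - iJv] by [i]. *)
Lemma freeR_J j x v : freeR j x v -> freeR j x (J x v).
Proof.
move=> Fv; have Dv := freeR_D Fv.
have := freeman_nat_lin 'i%C Fv (freeman_nat_zmod j x).1.
by move=> /freeRP[/=]; rewrite scale0r scale1r sub0r opprK addr0.
Qed.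

(** The real and imaginary parts of a complex frame form a real frame: a vector
    of type (1,0) whose real part vanishes is zero. *)
Lemma freeR_subbundle j : subbundle (freeR j).
Proof.
have [r bE] := freeman_distr C j; exists (r + r)%N => x.
have [U [e [oU Ux ve be]]] := bE x.
pose e' (i : 'I_(r + r)) : field M :=
  match fintype.split i with inl k => (e k).1 | inr k => (e k).2 end.
have e'E (a : 'I_(r + r) -> R) y :
    \sum_i a i *: e' i y = (\sum_k (a (lshift r k) -i* a (rshift r k))%C *:
      ceval y (e k)).1.
  rewrite fst_sum big_split_ord/= -big_split/=; apply: eq_bigr => k _.
  by rewrite /e' (unsplitK (inl _)) (unsplitK (inr _)) scaleNr opprK.
exists U, e'; split=> // [i|y Uy].
  by rewrite /e'; case: (fintype.split i) => k; have [] := ve k.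
split=> [v|a].
  split=> [Fv|[a ->]].
    have [a av] := ((be y Uy).1 _).1 Fv.
    exists (fun i => match fintype.split i with
      inl k => complex.Re (a k) | inr k => - complex.Im (a k) end).
    rewrite e'E -[LHS]/(v, - J y v).1 av; congr (_.1); apply: eq_bigr => k _.
    by rewrite (unsplitK (inl _)) (unsplitK (inr _)) opprK; case: (a k).
  rewrite e'E.
  set z := \sum_k _; suff /freeRP[] : freeman_nat C j y z by [].
  by apply/((be y Uy).1 _); eexists.
rewrite e'E; set z := \sum_k _ => z10.
have z0 : z = 0.
  have /freeRP[_ z2] : freeman_nat C j y z by apply/((be y Uy).1 _); eexists.
  by rewrite [z]surjective_pairing z2 z10 crJ0 oppr0.
have a0 := (be y Uy).2 _ z0.
move=> i; case: (split_ordP i) => k ->; have [] := a0 k => //.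
by move=> _ /eqP; rewrite oppr_eq0 => /eqP.
Qed.

Lemma freeman_modP j Z : freeman_mod S j Z <->
  sections (freeR j) Z.1 /\ Z.2 = - Jfield S Z.1.
Proof.
rewrite (freeman_sections C); split=> [[v1 v2 FZ]|[[v1 FZ] Z2]].
  split; first by split=> // x; have /freeRP[] := FZ x.
  by apply/funext => x; have /freeRP[] := FZ x.
have sD : sections D Z.1 by split=> // x; exact: freeR_D (FZ x).
split=> //; first by rewrite Z2; apply: vfieldN; exact: (Jfield_sections sD).1.
by move=> x; apply/freeRP; split; [exact: FZ|rewrite /= Z2].
Qed.

Lemma reFP (p : int) x v : reF C p x v <-> freeR (absz (p + 1)) x v.
Proof.
set j := absz _; split=> [[a [_ [Fa [b Fb <-]]]]|Fv].
  have /freeRP[Fa1 a2] := Fa; have /freeRP[Fb1 b2] := Fb.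
  have Da := freeR_D Fa1; have Db := freeR_D Fb1.
  move=> [/= -> /eqP]; rewrite a2 b2 opprK eq_sym addrC subr_eq0 => /eqP Jab.
  apply: (distrD (freeR_subbundle j)) => //.
exists (2^-1 *: v, - J x (2^-1 *: v)), (2^-1 *: v, J x (2^-1 *: v)).
have F2 : freeR j x (2^-1 *: v) by exact: (distrZ (freeR_subbundle j)).
split=> //.
  by exists (2^-1 *: v, - J x (2^-1 *: v)) => //; rewrite /cconj/= opprK.
congr pair; rewrite /= ?addNr//.
by rewrite -mulr2n -scaler_nat scalerA mulfV ?scale1r.
Qed.

End Freeman.

(** * Brackets and the Freeman sequence *)

Section FreemanBrackets.
Context (R : realType) (n : nat) (M : manifold R n) (S : CR_structure M).
Variable C : regular_CR S.
Implicit Types (X Y : field M) (v w : Tvec M) (Z W : cplx (field M)).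
Local Notation D := (crD S).
Local Notation J := (crJ S).
Local Notation bD := (crD_subbundle S).
Local Notation F := (freeman_mod S).
Local Notation sD01 := (csections (D01 S)).

(** [F_(j-1)^10 + D^01] at the level of sections, modulo which the Levi form of
    [F_(j-1)^10] is defined. *)
Definition levi_mod (j : nat) : set (cplx (field M)) := setsum (F j) sD01.

Definition levi_fib (j : nat) (x : M) : set (cplx (Tvec M)) :=
  setsum (freeman_nat C j x) (D01 S x).

Lemma levi_mod_zmod j : zmodset (levi_mod j).
Proof.
by apply: zmodset_setsum; [exact: (freeman_mod_zmod C)|exact: csections01_zmod].
Qed.

Lemma levi_fib_zmod j x : zmodset (levi_fib j x).
Proof.
by apply: zmodset_setsum; [exact: freeman_nat_zmod|exact: D01_zmod].
Qed.

Lemma levi_modE j Z x : levi_mod j Z -> levi_fib j x (ceval x Z).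
Proof.
move=> [A [B [FA [_ _ DB] ->]]]; exists (ceval x A), (ceval x B); split=> //.
exact: freeman_modE.
Qed.

Lemma freeman_cvfield j Z : F j Z -> cvfield Z.
Proof. by move=> /freeman_mod_D10/csections_cvfield. Qed.

Lemma csections_conj01 Z : sD01 Z -> csections (D10 S) (cconj Z).
Proof. by move=> sZ; apply/csections_conj; rewrite cconjK. Qed.

(** In the lowest degree [F_(-1)^10 + D^01] is the complexification of [D], so
    it is closed under conjugation. *)
Lemma cconj_levi_mod0 Z : levi_mod 0 (cconj Z) -> levi_mod 0 Z.
Proof.
move=> [A [B [FA DB e]]]; exists (cconj B), (cconj A); split.
- exact: csections_conj01.
- exact/csections_conj.
- rewrite -[LHS]cconjK e addrC; congr pair => //=; exact: opprD.
Qed.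

(** By induction on [j].  If [A] is the part of type (1,0) of [[Z, W]], then
    modulo [D^01] its bracket with [V] in [D^01] is
    [[Z, [W, V]] - [W, [Z, V]]] by the Jacobi identity; the first term is in
    [F_(j-1)^10 + D^01] by definition, the second one by induction. *)
Lemma freeman_conj_bracket j Z W : F j Z -> F 1 (cconj W) ->
  levi_mod j (clie Z W).
Proof.
move=> FZ FW; have DW : sD01 W.
  by rewrite -[W]cconjK; apply/csections_conj/freeman_mod_D10/FW.
have vW := csections_cvfield DW.
elim: j Z FZ => [|j IHj] Z FZ.
  have vZ := freeman_cvfield FZ; apply: cconj_levi_mod0.
  rewrite -clie_conj// clieC; apply: (zmodsetN (levi_mod_zmod 0)).
  by apply: FW.2; exact/csections_conj.
have vZ := freeman_cvfield FZ.
have [A [B [FA DB ZW]]] := FZ.2 W DW.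
have vA := freeman_cvfield FA; have vB := csections_cvfield DB.
exists A, B; split=> //; split=> // V DV; have vV := csections_cvfield DV.
have -> : clie A V = clie Z (clie W V) - clie W (clie Z V) - clie B V.
  have -> : A = clie Z W - B by rewrite ZW addrK.
  rewrite clieBl//; last exact: clie_cvfield.
  by rewrite (clie_jacobi vZ vW vV) addrK.
apply: (levi_mod_zmod j).2; last first.
  by apply: setsumr (clie01 DB DV); exact: freeman_mod_zmod C _.
apply: (levi_mod_zmod j).2; first by apply: FZ.2; exact: clie01.
have [A' [B' [FA' DB' ->]]] := FZ.2 V DV.
have vA' := freeman_cvfield FA'; have vB' := csections_cvfield DB'.
rewrite clieDr//; apply: (zmodsetD (levi_mod_zmod j)).
  by rewrite clieC; apply: (zmodsetN (levi_mod_zmod j)); exact: IHj.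
by apply: setsumr (clie01 DW DB'); exact: freeman_mod_zmod C _.
Qed.

Lemma Jfield_sum N (b : 'I_N -> M -> R) (s : 'I_N -> field M) :
  (forall i, sections D (s i)) ->
  Jfield S (\sum_i fscale (b i) (s i)) = \sum_i fscale (b i) (Jfield S (s i)).
Proof.
move=> sD; apply/funext => x.
have sumE (t : 'I_N -> field M) : (\sum_i t i) x = \sum_i t i x by rewrite fct_sumE.
rewrite /Jfield !sumE.
elim: (index_enum _) => [|i r IHr]; first by rewrite !big_nil crJ0.
rewrite !big_cons crJD.
- by rewrite IHr /fscale crJZ//; exact: (sD i).2.
- by apply: (distrZ bD); exact: (sD i).2.
elim: r {IHr} => [|k r IHr]; first by rewrite big_nil; exact: (distr0 bD).
by rewrite big_cons; apply: (distrD bD) => //; apply: (distrZ bD); exact: (sD k).2.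
Qed.

(** The coefficients in [clie_at_zero] multiply vectors [s_i - iJs_i] with [s_i]
    in [Re F_(j-1)]. *)
Lemma freeman_vanishing j Z W x : F j Z -> ceval x Z = 0 -> cvfield W ->
  freeman_nat C j x (ceval x (clie Z W)).
Proof.
move=> FZ Zx vW; have /(freeman_modP C)[sZ Z2] := FZ.
have Z1x : Z.1 x = 0 by have := congr1 (fun z : cplx _ => z.1) Zx.
have [N [b [s [sb b0 ss Z1]]]] := section_hadamard (freeR_subbundle C j) sZ Z1x.
have sD i : sections D (s i).
  by split; [exact: (ss i).1|move=> y; exact: freeR_D ((ss i).2 y)].
have sJ i := sectionsN bD (Jfield_sections (sD i)).
rewrite (@clie_at_zero _ _ _ _ _ _ N b s (fun i => - Jfield S (s i)))//.
- apply: (zmodsetN (freeman_nat_zmod C j x)).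
  elim: (index_enum _) => [|i r IHr].
    by rewrite big_nil; exact: (freeman_nat_zmod C j x).1.
  by rewrite big_cons; apply: freeman_nat_lin => //; exact: (ss i).2.
- by move=> i; exact: (ss i).1.
- by move=> i; exact: (sJ i).1.
- rewrite [LHS]surjective_pairing Z2 Z1; congr pair.
  rewrite Jfield_sum// -sumrN; apply: eq_bigr => i _.
  by apply/funext => y; rewrite /fscale scalerN.
Qed.

(** The same with the vectors [s_i + iJs_i]. *)
Lemma D01_vanishing Z W x : sD01 Z -> ceval x Z = 0 -> cvfield W ->
  D01 S x (ceval x (clie Z W)).
Proof.
move=> DZ Zx vW; have /csections01P[sZ Z2] := DZ.
have Z1x : Z.1 x = 0 by have := congr1 (fun z : cplx _ => z.1) Zx.
have [N [b [s [sb b0 ss Z1]]]] := section_hadamard bD sZ Z1x.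
have sJ i := Jfield_sections (ss i).
rewrite (@clie_at_zero _ _ _ _ _ _ N b s (fun i => Jfield S (s i)))//.
- apply: (zmodsetN (D01_zmod S x)).
  elim: (index_enum _) => [|i r IHr].
    by rewrite big_nil; exact: (D01_zmod S x).1.
  rewrite big_cons; apply: D01_lin => //.
  by have [_ _ DA] := ahol_csections (ss i); exact: DA.
- by move=> i; exact: (ss i).1.
- by move=> i; exact: (sJ i).1.
- by rewrite [LHS]surjective_pairing Z2 Z1; congr pair; rewrite Jfield_sum.
Qed.

(** Together with [levi_kernel_right] this makes the Levi form at [x] depend
    only on the classes of its arguments. *)
Lemma levi_kernel_left j Z W x : F j Z -> freeman_nat C j.+1 x (ceval x Z) ->
  sD01 W -> levi_fib j x (ceval x (clie Z W)).
Proof.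
move=> FZ /freeman_extend[Z' FZ' Z'x] DW.
have vW := csections_cvfield DW; have vZ := freeman_cvfield FZ.
have vZ' := freeman_cvfield FZ'.
have -> : clie Z W = clie Z' W + clie (Z - Z') W by rewrite clieBl// addrC subrK.
rewrite cevalD; apply: (zmodsetD (levi_fib_zmod j x)).
  by apply: levi_modE; exact: FZ'.2.
apply: setsuml; first exact: D01_zmod.
apply: freeman_vanishing => //.
  by apply: (freeman_mod_zmod C j).2 => //; exact: FZ'.1.
by rewrite -[LHS]/(ceval x Z - ceval x Z') Z'x subrr.
Qed.

Lemma levi_kernel_right j Z W x : F j Z -> sD01 W ->
  freeman_nat C 1 x (cconj (ceval x W)) -> levi_fib j x (ceval x (clie Z W)).
Proof.
move=> FZ DW /freeman_extend[W' FW' W'x].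
have DW' : sD01 (cconj W') by apply/csections_conj/freeman_mod_D10/FW'.
have vW := csections_cvfield DW; have vZ := freeman_cvfield FZ.
have vW' := csections_cvfield DW'.
have -> : clie Z W = clie Z (cconj W') + clie Z (W - cconj W').
  by rewrite clieBr// addrC subrK.
rewrite cevalD; apply: (zmodsetD (levi_fib_zmod j x)).
  by apply: levi_modE; apply: freeman_conj_bracket; rewrite ?cconjK.
rewrite clieC cevalN; apply: (zmodsetN (levi_fib_zmod j x)).
apply: setsumr; first exact: freeman_nat_zmod.
apply: D01_vanishing => //; first exact: ((csections01_zmod S).2 _ _ DW DW').
rewrite -[LHS]/(ceval x W - cconj (ceval x W')) W'x cconjK subrr//.
Qed.

(** The sum of [D^10] and [D^01] is direct. *)
Lemma levi_fib_freeman j k x z : (j <= k)%N -> freeman_nat C j x z ->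
  levi_fib k x z -> freeman_nat C k x z.
Proof.
move=> jk Fz [a [b [Fa Db zab]]].
have Dz := freeman_nat_D10 Fz; have Da := freeman_nat_D10 Fa.
have b0 : b = 0.
  apply: (@D10D01_disjoint _ _ _ S x) => //.
  have -> : b = z - a by rewrite zab addrC addKr.
  by apply/(freeman_nat0 C); apply: (freeman_nat_zmod C 0 x).2; exact/(freeman_nat0 C).
by rewrite zab b0 addr0.
Qed.

End FreemanBrackets.

(** * Brackets and the Tanaka sequence *)

Section TanakaBrackets.
Context (R : realType) (n : nat) (M : manifold R n) (S : CR_structure M).
Variable C : regular_CR S.
Implicit Types (X Y Z : field M) (v w : Tvec M).
Local Notation D := (crD S).
Local Notation J := (crJ S).
Local Notation bD := (crD_subbundle S).
Local Notation T := (tanaka_mod S).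

Lemma tanaka_subbundle j : subbundle (tanaka_nat C j).
Proof. exact: tanaka_distr. Qed.

Lemma tanaka_mod_zmod j : zmodset (T j).
Proof.
rewrite (tanaka_sections C); have bT := tanaka_subbundle j.
by split=> [|X Y]; [exact: sections0|exact: sectionsB].
Qed.

Lemma tanaka_modE j X x : T j X -> tanaka_nat C j x (X x).
Proof. by rewrite (tanaka_sections C) => -[]. Qed.

Lemma tanaka_extend j x v : tanaka_nat C j x v -> exists2 X, T j X & X x = v.
Proof. by rewrite (tanaka_sections C); exact: (distr_section (tanaka_subbundle j)). Qed.

Lemma tanaka_vfield j X : T j X -> vfield X.
Proof. by rewrite (tanaka_sections C) => -[]. Qed.

Lemma tanaka_modSP j Z : T j.+1 Z <->
  exists A N (X Y : 'I_N -> field M), [/\ T j A, forall i, sections D (X i),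
    forall i, T j (Y i) & Z = A + \sum_(i < N) lie (X i) (Y i)].
Proof. by []. Qed.

Lemma tanaka_modS j X : T j X -> T j.+1 X.
Proof.
move=> TX; exists X, 0%N, (fun=> 0), (fun=> 0); split=> //; try by case.
by rewrite big_ord0 addr0.
Qed.

Lemma tanaka_mod_mono i j X : (i <= j)%N -> T i X -> T j X.
Proof.
by move=> /subnK <-; elim: (j - i)%N => [//|k IHk] /IHk; exact: tanaka_modS.
Qed.

Lemma tanaka_nat_mono i j x v : (i <= j)%N -> tanaka_nat C i x v ->
  tanaka_nat C j x v.
Proof.
by move=> ij /tanaka_extend[X /(tanaka_mod_mono ij) TX <-]; exact: tanaka_modE.
Qed.

Lemma tanaka_nat0 x v : tanaka_nat C 0 x v <-> D x v.
Proof.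
split=> [/tanaka_extend[X [_ DX] <-]//|/(distr_section bD)[X sX <-]].
exact: (@tanaka_modE 0).
Qed.

Lemma tanaka_mod_sum j (N : nat) (F : 'I_N -> field M) :
  (forall i, T j (F i)) -> T j (\sum_i F i).
Proof.
move=> TF; elim: (index_enum _) => [|i r IHr].
  by rewrite big_nil; exact: (tanaka_mod_zmod j).1.
by rewrite big_cons; apply: (zmodsetD (tanaka_mod_zmod j)).
Qed.

Lemma tanaka_bracket1 j X Y : sections D X -> T j Y -> T j.+1 (lie X Y).
Proof.
move=> sX TY; exists 0, 1%N, (fun=> X), (fun=> Y); split=> //.
  exact: (tanaka_mod_zmod j).1.
by rewrite big_ord1 add0r.
Qed.

(** By induction on [i] from the Jacobi identity. *)
Lemma tanaka_bracket i j X Y : T i X -> T j Y -> T (i + j).+1 (lie X Y).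
Proof.
elim: i j X Y => [|i IHi] j X Y; first exact: tanaka_bracket1.
move=> /tanaka_modSP[A [N [U [V [TA sU TV ->]]]]] TY.
have vA := tanaka_vfield TA; have vY := tanaka_vfield TY.
have vU k : vfield (U k) := (sU k).1; have vV k := tanaka_vfield (TV k).
have vUV k : vfield (lie (U k) (V k)) by exact: lie_vfield.
rewrite lieDl//; last first.
  under eq_bigr do rewrite -[lie _ _]scale1r.
  exact: vfield_on_sum openT _.
rewrite lie_suml//; apply: (zmodsetD (tanaka_mod_zmod _)).
  by apply: tanaka_modS; exact: IHi.
apply: tanaka_mod_sum => k.
have -> : lie (lie (U k) (V k)) Y = lie (U k) (lie (V k) Y) - lie (V k) (lie (U k) Y).
  by rewrite (lie_jacobi (vU k) (vV k) vY) addrK.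
apply: (tanaka_mod_zmod _).2.
  by rewrite addSn; apply: tanaka_bracket1 => //; exact: IHi.
by rewrite addSnnS; apply: IHi; [exact: TV|exact: tanaka_bracket1].
Qed.

Lemma tanaka_vanishing i X Y x : T i X -> X x = 0 -> vfield Y ->
  tanaka_nat C i x (lie X Y x).
Proof.
move=> TX Xx vY; have bT := tanaka_subbundle i.
have sX : sections (tanaka_nat C i) X by rewrite -(tanaka_sections C).
have [N [b [s [sb b0 ss ->]]]] := section_hadamard bT sX Xx.
rewrite lie_suml//; last by move=> k; apply: fscale_vfield => //; exact: (ss k).1.
rewrite fct_sumE; elim: (index_enum _) => [|k r IHr].
  by rewrite big_nil; exact: (distr0 bT).
rewrite big_cons; apply: (distrD bT) => //; rewrite lie_fscale//; last exact: (ss k).1.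
rewrite b0 scale0r sub0r; apply: (distrN bT); apply: (distrZ bT); exact: (ss k).2.
Qed.

(** The bracket of [X - iJX] with [Y + iJY] is in the complexification of [D] by
    the definition of [F_0], that with [Y - iJY] by involutivity; the real part
    of the sum is [2 [X, Y]]. *)
Lemma levi_kernel_D X Y : sections (freeR C 1) X -> sections D Y ->
  sections D (lie X Y).
Proof.
move=> sX sY; have sXD : sections D X.
  by split; [exact: sX.1|move=> y; exact: freeR_D (sX.2 y)].
have FX : freeman_mod S 1 (hol S X) by apply/(freeman_modP C); split.
have [A [B [FA DB AB]]] := FX.2 _ (ahol_csections sY).
have DAB : sections D (clie (hol S X) (ahol S Y)).1.
  rewrite AB; apply: (sectionsD bD).
    by have [] := csections10_Dcplx FA.
  by have [] := csections01_Dcplx DB.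
have DXY : sections D (clie (hol S X) (hol S Y)).1.
  apply: proj1; apply: csections10_Dcplx; apply: cr_involutive; exact: hol_csections.
have := sectionsD bD DAB DXY; rewrite /=.
have vJX := (Jfield_sections sXD).1; have vJY := (Jfield_sections sY).1.
rewrite lieNl// lieNl//; last exact: vfieldN.
rewrite lieNr// !opprK addrACA subrr addr0 => /(sections_lin bD 2^-1) s2.
have := s2 _ (sections0 bD); rewrite addr0 scalerDr.
by rewrite halfD.
Qed.

(** The Jacobi identity extends [levi_kernel_D] along the Tanaka sequence.  This
    is what the bracket needs in order to be defined on
    [m^(-1) = D / Re F_0]. *)
Lemma levi_kernel_tanaka j X Y : sections (freeR C 1) X -> T j Y -> T j (lie X Y).
Proof.
move=> sX; elim: j Y => [|j IHj] Y; first exact: levi_kernel_D.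
move=> /tanaka_modSP[A [N [U [V [TA sU TV ->]]]]].
have vA := tanaka_vfield TA; have vX := sX.1.
have vU k : vfield (U k) := (sU k).1; have vV k := tanaka_vfield (TV k).
have vUV k : vfield (lie (U k) (V k)) by exact: lie_vfield.
rewrite lieDr//; last first.
  under eq_bigr do rewrite -[lie _ _]scale1r.
  exact: vfield_on_sum openT _.
apply: (zmodsetD (tanaka_mod_zmod _)).
  by apply: tanaka_modS; exact: IHj.
rewrite lieC lie_suml//; apply: (zmodsetN (tanaka_mod_zmod _)).
apply: tanaka_mod_sum => k; rewrite lieC; apply: (zmodsetN (tanaka_mod_zmod _)).
rewrite lie_jacobi//; apply: (zmodsetD (tanaka_mod_zmod _)).
  by apply: tanaka_bracket1; [exact: levi_kernel_D|exact: TV].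
by apply: tanaka_bracket1; [exact: sU|exact: IHj].
Qed.

End TanakaBrackets.

(** * Quotients by subspaces, and permutations *)

Section Quotients.
Context (R : realType) (T : lmodType R).

(** In coordinates on [A], [B] becomes the row space of a matrix, and the
    quotient is the image of its cokernel. *)
Lemma quotient_exists rA rB (A B : set T) (eA : 'I_rA -> T) (eB : 'I_rB -> T) :
  is_basis A eA -> is_basis B eB -> B `<=` A ->
  exists (d : nat) (proj : T -> 'rV[R]_d), is_quotient A B proj.
Proof.
move=> bA bB BA; have [spanA indA] := bA; have [spanB indB] := bB.
have [c cE] : exists c : T -> 'rV[R]_rA, forall u, A u ->
    u = \sum_i c u 0 i *: eA i.
  have /choice[c cP] (u : T) : exists v : 'rV[R]_rA, A u -> u = \sum_i v 0 i *: eA i.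
    have [/spanA[a ->]|nA] := pselect (A u); last by exists 0.
    by exists (\row_i a i) => _; apply: eq_bigr => i _; rewrite mxE.
  by exists c.
have c_uniq u (v : 'rV[R]_rA) : A u -> u = \sum_i v 0 i *: eA i -> c u = v.
  move=> Au uv; apply/rowP => i; apply/eqP; rewrite -subr_eq0; apply/eqP.
  apply: (indA (fun i => c u 0 i - v 0 i)).
  by under eq_bigr do rewrite scalerBl; rewrite sumrB -cE// -uv subrr.
have c_lin a u v : A u -> A v -> c (a *: u + v) = a *: c u + c v.
  move=> Au Av; apply: c_uniq; first exact: is_basis_lin bA Au Av.
  rewrite {1}(cE u Au) {1}(cE v Av) scaler_sumr -big_split/=.
  by apply: eq_bigr => i _; rewrite !mxE scalerDl scalerA.
pose N := \matrix_(j < rB, i < rA) c (eB j) 0 i.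
have eBA j : A (eB j).
  apply/BA/spanB; exists (fun k => (k == j)%:R); rewrite (bigD1 j)//= eqxx scale1r.
  by rewrite big1 ?addr0// => k /negbTE ->; rewrite scale0r.
have N_lin (a : 'rV[R]_rB) : c (\sum_j a 0 j *: eB j) = a *m N.
  apply: c_uniq; first by apply/BA/spanB; exists (fun j => a 0 j).
  under [RHS]eq_bigr => i _ do rewrite mxE scaler_suml.
  rewrite exchange_big/=; apply: eq_bigr => j _.
  rewrite {1}(cE _ (eBA j)) scaler_sumr; apply: eq_bigr => i _.
  by rewrite scalerA mxE.
pose Q := cokermx N.
exists (\rank Q), (fun u => c u *m col_base Q); split.
- by move=> a u v Au Av; rewrite c_lin// mulmxDl scalemxAl.
- move=> y; have /row_fullP[L LQ] := col_base_full Q.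
  exists (\sum_i (y *m L) 0 i *: eA i).
    by apply/spanA; exists (fun i => (y *m L) 0 i).
  rewrite (c_uniq _ (y *m L))//; first by rewrite -mulmxA LQ mulmx1.
  by apply/spanA; exists (fun i => (y *m L) 0 i).
move=> u Au; split=> [cu0|/spanB[a uE]].
  have : (c u <= N)%MS.
    by rewrite submxE -/Q -[Q]mulmx_base mulmxA cu0 mul0mx.
  move=> /submxP[a ca]; apply/spanB; exists (fun j => a 0 j).
  have Bs : A (\sum_j a 0 j *: eB j) by apply/BA/spanB; exists (fun j => a 0 j).
  by rewrite (cE _ Au) ca -N_lin -cE.
apply: (row_free_inj (row_base_free Q)); rewrite mul0mx -mulmxA mulmx_base.
apply/eqP; rewrite -submxE; apply/submxP; exists (\row_j a j).
by rewrite -N_lin; congr c; rewrite uE; apply: eq_bigr => j _; rewrite mxE.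
Qed.

End Quotients.

(** The first element of [s] is moved to the front of [t] by exchanges of
    neighbours; then induction applies to the rest. *)
Lemma perm_eq_neighbours (T : eqType) (rT : Type) (f : seq T -> rT) (s t : seq T) :
  (forall s1 a b s2, perm_eq s (s1 ++ [:: a, b & s2]) ->
    f (s1 ++ [:: a, b & s2]) = f (s1 ++ [:: b, a & s2])) ->
  perm_eq s t -> f s = f t.
Proof.
elim: s f t => [|x s IHs] f t fswap.
  by rewrite perm_sym => /perm_nilP ->.
move=> pst; have xt : x \in t by rewrite -(perm_mem pst) mem_head.
case/splitPr: t / xt pst => t1 t2 pst.
have ps : perm_eq s (t1 ++ t2).
  by rewrite -(perm_cons x) (perm_trans pst)// -cat_rcons -cats1 -catA perm_catCA.
have move_front (u1 u2 : seq T) : perm_eq (x :: s) (x :: u1 ++ u2) ->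
    f (x :: u1 ++ u2) = f (u1 ++ x :: u2).
  elim/last_ind: u1 u2 => [//|u1 y IHu] u2 pu.
  rewrite cat_rcons IHu -?cat_rcons// !cat_rcons.
  apply: fswap; rewrite (perm_trans pu)// cat_rcons.
  by rewrite -[x :: _]/([:: x] ++ u1 ++ _) perm_catCA.
rewrite -move_front; last by rewrite perm_cons.
apply: (IHs (fun u => f (x :: u))) ps => s1 a b s2 ps1.
by rewrite -!cat_cons; apply: fswap; rewrite /= perm_cons.
Qed.

(** * Levi forms at a point *)

Section LeviForms.
Context (R : realType) (n : nat) (M : manifold R n) (S : CR_structure M).
Variable C : regular_CR S.
Implicit Types (X Y : field M) (v w : Tvec M) (Z W : cplx (field M)).
Local Notation D := (crD S).
Local Notation J := (crJ S).
Local Notation bD := (crD_subbundle S).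
Local Notation F := (freeman_mod S).
Local Notation T := (tanaka_mod S).
Local Notation sD01 := (csections (D01 S)).

Lemma subbundle_basis (E : M -> set (Tvec M)) x : subbundle E ->
  exists (r : nat) (e : 'I_r -> Tvec M), is_basis (E x) e.
Proof.
by move=> [r rE]; have [U [e [_ Ux _ be]]] := rE x; exists r, (fun i => e i x); exact: be.
Qed.

Lemma freeman_mod_lin j (a : R[i]) Z W : F j Z -> F j W -> F j (a *: Z + W).
Proof.
rewrite (freeman_sections C) => -[vZ1 vZ2 FZ] [vW1 vW2 FW].
have [v1 v2] := cvfieldD (cvfieldZ a (conj vZ1 vZ2)) (conj vW1 vW2).
by split=> // x; exact: freeman_nat_lin (FZ x) (FW x).
Qed.

Lemma csections01_lin (a : R[i]) Z W : sD01 Z -> sD01 W -> sD01 (a *: Z + W).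
Proof.
move=> [vZ1 vZ2 FZ] [vW1 vW2 FW].
have [v1 v2] := cvfieldD (cvfieldZ a (conj vZ1 vZ2)) (conj vW1 vW2).
by split=> // x; exact: D01_lin (FZ x) (FW x).
Qed.

(** Two successive brackets with sections of [D^01] can be exchanged, because
    the bracket of these sections is again a section of [D^01]. *)
Lemma levi_swap j Z A A' W W' : F j.+1 Z -> F j A -> F j A' ->
  sD01 W -> sD01 W' -> sD01 (clie Z W - A) -> sD01 (clie Z W' - A') ->
  levi_mod S j (clie A W' - clie A' W).
Proof.
move=> FZ FA FA' DW DW' DB DB'.
have vZ := freeman_cvfield FZ; have vA := freeman_cvfield FA.
have vA' := freeman_cvfield FA'; have vW := csections_cvfield DW.
have vW' := csections_cvfield DW'.
set B := clie Z W - A in DB; set B' := clie Z W' - A' in DB'.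
have vB := csections_cvfield DB; have vB' := csections_cvfield DB'.
have AE : A = clie Z W - B by rewrite /B opprB addrC subrK.
have AE' : A' = clie Z W' - B' by rewrite /B' opprB addrC subrK.
have -> : clie A W' - clie A' W =
    clie Z (clie W W') - (clie B W' - clie B' W).
  rewrite AE AE' !clieBl//; try exact: clie_cvfield.
  rewrite (clie_jacobi vZ vW vW') [clie W (clie Z W')]clieC.
  by rewrite !opprB addrACA [RHS]addrACA; congr (_ + _); exact: addrC.
apply: (levi_mod_zmod C j).2; first by apply: FZ.2; exact: clie01.
apply: setsumr; first exact: freeman_mod_zmod C _.
by apply: (csections01_zmod S).2; exact: clie01.
Qed.

(** The fibre by which [D_(-1-i)] is divided: [Re F_0] for [i = 0], where the
    Freeman sequence takes over, and [D_(-i)] otherwise. *)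
Definition tanaka_den (i : nat) (x : M) : set (Tvec M) :=
  if i is i'.+1 then tanaka_nat C i' x else freeR C 1 x.

(** [X] is the sum of a section of the next term of the sequence and of a
    section that vanishes at [x]. *)
Lemma tanaka_den_bracket i j X Y x : T i X -> T j Y -> tanaka_den i x (X x) ->
  tanaka_nat C (i + j) x (lie X Y x).
Proof.
move=> TX TY dX; have vX := tanaka_vfield C TX; have vY := tanaka_vfield C TY.
have [X' [TX' X'x TXY]] : exists X', [/\ T i X', X' x = X x & T (i + j) (lie X' Y)].
  case: i TX dX => [|i] TX /=.
    move=> /(distr_section (freeR_subbundle C 1))[X' sX' X'x]; exists X'; split=> //.
      by split; [exact: sX'.1|move=> y; exact: freeR_D (sX'.2 y)].
    exact: levi_kernel_tanaka sX' TY.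
  move=> /tanaka_extend[X' TX' X'x]; exists X'; split=> //.
    exact: tanaka_modS.
  exact: tanaka_bracket C _ _ _ _ TX' TY.
have vX' := tanaka_vfield C TX'.
have -> : lie X Y = lie X' Y + lie (X - X') Y by rewrite lieBl// addrC subrK.
apply: (distrD (tanaka_subbundle C _)); first exact: tanaka_modE.
apply: tanaka_nat_mono (leq_addr j i) _.
apply: tanaka_vanishing => //; first exact: (tanaka_mod_zmod C i).2.
by rewrite -[LHS]/(X x - X' x) X'x subrr.
Qed.

(** The Levi form of [X - iJX] at [x] involves the brackets of [X] and of [JX]
    with [D]; those of [JX] are brackets of [X] up to sign modulo [D], by
    involutivity. *)
Lemma levi_nondegenerate X x : sections D X ->
  (forall Y, sections D Y -> D x (lie X Y x)) -> freeR C 1 x (X x).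
Proof.
move=> sX brX; have sJX := Jfield_sections sX; have vX := sX.1; have vJX := sJX.1.
have FX := hol_csections sX.
suff : freeman_nat C 1 x (ceval x (hol S X)) by move=> /freeRP[].
apply: freeman_kernel => // W /csections01P[sW W2].
have sJW := Jfield_sections sW; have vW := sW.1; have vJW := sJW.1.
have [s1 s2] := lie_Jfield sX sW.
have [z [w [Dz Dw ->]]] : setsum (D10 S x) (D01 S x) (ceval x (clie (hol S X) W)).
  apply: D10D01_split; rewrite /= W2 lieNl//.
    rewrite opprK.
    rewrite -[X in D x X]/(lie X W.1 x + lie (Jfield S X) (Jfield S W.1) x).
    apply: (distrD bD); first exact: brX.
    have -> : lie (Jfield S X) (Jfield S W.1) x = lie X W.1 x -
        (lie X W.1 - lie (Jfield S X) (Jfield S W.1)) x.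
      by rewrite -[(_ - _) x]/(lie X W.1 x - _ x) opprB addrC subrK.
    by apply: (distrB bD); [exact: brX|exact: s1.2].
  rewrite -[X in D x X]/(lie X (Jfield S W.1) x - lie (Jfield S X) W.1 x).
  apply: (distrB bD); first exact: brX.
  have -> : lie (Jfield S X) W.1 x = 
      (lie X (Jfield S W.1) + lie (Jfield S X) W.1) x - lie X (Jfield S W.1) x.
    by rewrite -[(_ + _) x]/(lie X (Jfield S W.1) x + _ x) addrC addKr.
  by apply: (distrB bD); [exact: s2.2|exact: brX].
by exists z, w; split=> //; exact/freeman_nat0.
Qed.

End LeviForms.

Definition pick_or (T : Type) (t0 : T) (P : T -> Prop) : T :=
  if pselect (exists t, P t) is left e then projT1 (cid e) else t0.

Lemma pick_orP (T : Type) (t0 : T) (P : T -> Prop) :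
  (exists t, P t) -> P (pick_or t0 P).
Proof. by rewrite /pick_or; case: pselect => // e _; exact: projT2 (cid e). Qed.

(** * The core at a point *)

Section NaturalCore.
Context (R : realType) (n : nat) (M : manifold R n) (S : CR_structure M).
Variables (C : regular_CR S) (x : M).
Variables (V : int -> vectType R) (proj : forall p, Tvec M -> V p).
Hypothesis projP : forall p, is_quotient (mx_num C x p) (mx_den C x p) (@proj p).
Implicit Types (X Y : field M) (v : Tvec M) (p q r : int).
Local Notation D := (crD S).
Local Notation J := (crJ S).
Local Notation bD := (crD_subbundle S).
Local Notation F := (freeman_mod S).
Local Notation T := (tanaka_mod S).
Local Notation sD01 := (csections (D01 S)).
Local Notation num := (mx_num C x).
Local Notation den := (mx_den C x).

(** Position of degree [p] in the sequence that it belongs to. *)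
Definition level p : nat := absz (p + 1).

Lemma levelS p : -1 <= p -> level (p + 1) = (level p).+1.
Proof. by rewrite /level; lia. Qed.

Lemma level_pred p : 0 <= p -> level p = (level (p - 1)).+1.
Proof. by rewrite /level; lia. Qed.

Lemma level_neg p : p <= -2 -> level p = (level (p + 1)).+1.
Proof. by rewrite /level; lia. Qed.

Lemma levelD p q : p < 0 -> q < 0 -> level (p + q) = (level p + level q).+1.
Proof. by rewrite /level; lia. Qed.

Lemma num_pos p v : -1 <= p -> num p v <-> freeR C (level p) x v.
Proof.
by move=> p1; rewrite /mx_num ifF; [exact: reFP|lia].
Qed.

Lemma den_pos p v : -1 <= p -> den p v <-> freeR C (level p).+1 x v.
Proof.
move=> p1; rewrite /mx_den ifF; last lia.
by rewrite -levelS//; exact: reFP.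
Qed.

(** The two sequences share the degree [-1], where both give [D]. *)
Lemma num_neg p v : p < 0 -> num p v <-> tanaka_nat C (level p) x v.
Proof.
move=> p0; have [p2|p2] := boolP (p <= -2).
  by rewrite /mx_num p2.
have -> : p = -1 by lia.
have l0 : level (-1) = 0%N by [].
have [H1 H2] := num_pos v (lexx (-1)); rewrite l0 in H1 H2 *.
split=> [/H1/freeR0 Dv|/tanaka_nat0 Dv]; first exact/tanaka_nat0.
by apply: H2; exact/freeR0.
Qed.

Lemma den_neg p v : p < 0 -> den p v <-> tanaka_den C (level p) x v.
Proof.
move=> p0; have [p2|p2] := boolP (p <= -2).
  by rewrite /mx_den p2 level_neg.
have -> : p = -1 by lia.
have l0 : level (-1) = 0%N by [].
by have := den_pos v (lexx (-1)); rewrite l0.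
Qed.

Lemma num_lin p (a : R) v w : num p v -> num p w -> num p (a *: v + w).
Proof.
have [p0|p0] := ltP p 0.
  by rewrite !num_neg//; exact: (distr_lin (tanaka_subbundle C _)).
have p1 : -1 <= p by lia.
by rewrite !num_pos//; exact: (distr_lin (freeR_subbundle C _)).
Qed.

Lemma num0 p : num p 0.
Proof.
have [_ /(_ 0)[v nv _] _] := projP p.
by rewrite -(addNr v) -scaleN1r; exact: num_lin.
Qed.

Lemma numZ p (a : R) v : num p v -> num p (a *: v).
Proof.
by move=> nv; rewrite -[_ *: _]addr0; apply: num_lin => //; exact: num0.
Qed.

Lemma numN p v : num p v -> num p (- v).
Proof. by rewrite -scaleN1r; exact: numZ. Qed.

Lemma numD p v w : num p v -> num p w -> num p (v + w).
Proof. by rewrite -[X in _ (X + _)]scale1r; exact: num_lin. Qed.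

Lemma numB p v w : num p v -> num p w -> num p (v - w).
Proof. by move=> nv /numN; exact: numD. Qed.

Lemma proj_lin p (a : R) v w : num p v -> num p w ->
  proj p (a *: v + w) = a *: proj p v + proj p w.
Proof. by have [+ _ _] := projP p; apply. Qed.

Lemma projD p v w : num p v -> num p w -> proj p (v + w) = proj p v + proj p w.
Proof. by move=> nv nw; have := proj_lin 1 nv nw; rewrite !scale1r. Qed.

Lemma proj0 p : proj p 0 = 0.
Proof.
have := projD (num0 p) (num0 p); rewrite addr0.
by move=> /(congr1 (fun u => u - proj p 0)); rewrite addrK subrr.
Qed.

Lemma projZ p (a : R) v : num p v -> proj p (a *: v) = a *: proj p v.
Proof. by move=> nv; have := proj_lin a nv (num0 p); rewrite proj0 !addr0. Qed.

Lemma projN p v : num p v -> proj p (- v) = - proj p v.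
Proof. by move=> nv; rewrite -scaleN1r projZ// scaleN1r. Qed.

Lemma projB p v w : num p v -> num p w -> proj p (v - w) = proj p v - proj p w.
Proof. by move=> nv nw; rewrite projD ?projN//; exact: numN. Qed.

Lemma proj_onto p u : exists2 v, num p v & proj p v = u.
Proof. by have [_ + _] := projP p; apply. Qed.

Lemma proj_eq0 p v : num p v -> proj p v = 0 <-> den p v.
Proof. by have [_ _ +] := projP p; apply. Qed.

Lemma proj_eq p v w : num p v -> num p w -> den p (v - w) -> proj p v = proj p w.
Proof.
move=> nv nw /(proj_eq0 (numB nv nw)); rewrite projB// => /eqP.
by rewrite subr_eq0 => /eqP.
Qed.

Lemma num_sec p X : p < 0 -> tanaka_sec S p X -> num p (X x).
Proof. by move=> p0 TX; apply/num_neg => //; exact: tanaka_modE. Qed.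

Lemma sec_onto p u : p < 0 -> exists X, tanaka_sec S p X /\ proj p (X x) = u.
Proof.
move=> p0; have [v /(num_neg _ p0)/tanaka_extend[X TX <-] <-] := proj_onto u.
by exists X.
Qed.

Lemma num_D p v : -1 <= p -> num p v -> D x v.
Proof. by move=> p1 /(num_pos _ p1)/freeR_D. Qed.

Lemma num_J p v : -1 <= p -> num p v -> num p (J x v).
Proof. by move=> p1 /(num_pos _ p1)/freeR_J nv; exact/num_pos. Qed.

Definition coreJ p (u : V p) : V p :=
  proj p (J x (pick_or 0 (fun v => num p v /\ proj p v = u))).

Definition sec_of p (u : V p) : field M :=
  pick_or 0 (fun X => tanaka_sec S p X /\ proj p (X x) = u).

(** The bracket of chosen representatives; [core_br_proj] shows that the choice
    does not matter. *)
Definition core_br p q r (u : V p) (v : V q) : V r :=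
  if r == p + q then proj r (lie (sec_of u) (sec_of v) x) else 0.

(** [Z] represents the value of the higher order Levi form on the classes [z] and
    [w]. *)
Definition levi_rel p (z : cplx (V p)) (w : cplx (V (-1))) (Z : cplx (Tvec M)) : Prop :=
  exists X Y : cplx (field M),
  [/\ freeman_sec S p X, sD01 Y, freeman10 C (p - 1) x Z,
      D01 S x (ceval x (clie X Y) - Z) &
      cmap (proj p) (ceval x X) = z /\ cmap (proj (-1)) (ceval x Y) = w].

Definition coreL p (z : cplx (V p)) (w : cplx (V (-1))) : cplx (V (p - 1)) :=
  cmap (proj (p - 1)) (pick_or 0 (levi_rel z w)).

Definition core : core_data R := CoreData coreJ core_br coreL.

(** [J] preserves the fibres that are divided out. *)
Lemma coreJ_proj p v : -1 <= p -> num p v -> coreJ (proj p v) = proj p (J x v).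
Proof.
move=> p1 nv; rewrite /coreJ.
set u := pick_or _ _; have [nu uE] : num p u /\ proj p u = proj p v.
  by apply: (@pick_orP _ 0 (fun w => num p w /\ proj p w = proj p v)); exists v.
apply: proj_eq; [exact: num_J|exact: num_J|].
have duv : den p (u - v) by apply/(proj_eq0 (numB nu nv)); rewrite projB// uE subrr.
rewrite -(crJB (num_D p1 nu) (num_D p1 nv)).
by apply/den_pos => //; apply: freeR_J; exact/den_pos.
Qed.

Lemma num_lie p q r X Y : p < 0 -> q < 0 -> r = p + q ->
  tanaka_sec S p X -> tanaka_sec S q Y -> num r (lie X Y x).
Proof.
move=> p0 q0 rE TX TY; have r0 : r < 0 by lia.
apply/num_neg => //; rewrite rE levelD//.
by apply: tanaka_modE; exact: tanaka_bracket.
Qed.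

(** The difference of two brackets is the sum of two brackets in which one
    argument has class zero, and [tanaka_den_bracket] applies to each. *)
Lemma core_br_proj p q r X Y : p < 0 -> q < 0 -> r = p + q ->
  tanaka_sec S p X -> tanaka_sec S q Y ->
  core_br r (proj p (X x)) (proj q (Y x)) = proj r (lie X Y x).
Proof.
move=> p0 q0 rE TX TY; rewrite /core_br rE eqxx.
set X' := sec_of _; set Y' := sec_of _.
have [TX' X'x] : tanaka_sec S p X' /\ proj p (X' x) = proj p (X x).
  apply: (@pick_orP _ 0 (fun A => tanaka_sec S p A /\ proj p (A x) = proj p (X x))).
  by exists X.
have [TY' Y'x] : tanaka_sec S q Y' /\ proj q (Y' x) = proj q (Y x).
  apply: (@pick_orP _ 0 (fun A => tanaka_sec S q A /\ proj q (A x) = proj q (Y x))).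
  by exists Y.
have pq0 : p + q < 0 by lia.
apply: proj_eq; [exact: (num_lie p0 q0)|exact: (num_lie p0 q0)|].
have dX : tanaka_den C (level p) x ((X' - X) x).
  apply/den_neg => //; rewrite -[(X' - X) x]/(X' x - X x).
  by apply/proj_eq0; [apply: numB; exact: num_sec|rewrite projB ?X'x ?subrr//; exact: num_sec].
have dY : tanaka_den C (level q) x ((Y' - Y) x).
  apply/den_neg => //; rewrite -[(Y' - Y) x]/(Y' x - Y x).
  by apply/proj_eq0; [apply: numB; exact: num_sec|rewrite projB ?Y'x ?subrr//; exact: num_sec].
have TdX : T (level p) (X' - X) by exact: (tanaka_mod_zmod C _).2.
have TdY : T (level q) (Y' - Y) by exact: (tanaka_mod_zmod C _).2.
have vX := tanaka_vfield C TX; have vX' := tanaka_vfield C TX'.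
have vY := tanaka_vfield C TY; have vY' := tanaka_vfield C TY'.
have -> : lie X' Y' x - lie X Y x = lie (X' - X) Y' x - lie (Y' - Y) X x.
  rewrite lieBl// lieBl// [lie Y' X]lieC [lie Y X]lieC.
  rewrite -[(lie X' Y' - lie X Y') x]/(lie X' Y' x - lie X Y' x).
  rewrite -[(- lie X Y' - - lie X Y) x]/(- lie X Y' x - - lie X Y x).
  move: (lie X' Y' x) (lie X Y x) (lie X Y' x) => a b c.
  by rewrite opprB opprK [- b + c]addrC addrA subrK.
apply/den_neg => //; rewrite levelD//=.
apply: (distrB (tanaka_subbundle C _)).
  exact: tanaka_den_bracket TdX TY' dX.
by rewrite addnC; exact: tanaka_den_bracket TdY TX dY.
Qed.

Lemma num10 p (z : cplx (Tvec M)) : -1 <= p -> freeman10 C p x z ->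
  num p z.1 /\ num p z.2.
Proof.
move=> p1 /freeRP[Fz z2]; split; first exact/num_pos.
by rewrite z2; apply: numN; apply: num_J => //; exact/num_pos.
Qed.

Lemma cmap_projB p (z w : cplx (Tvec M)) : -1 <= p ->
  freeman10 C p x z -> freeman10 C p x w ->
  cmap (proj p) (z - w) = cmap (proj p) z - cmap (proj p) w.
Proof.
move=> p1 /(num10 p1)[z1 z2] /(num10 p1)[w1 w2].
by congr pair; rewrite /= projB.
Qed.

Lemma cmap_proj_lin p (a : R[i]) (z w : cplx (Tvec M)) : -1 <= p ->
  freeman10 C p x z -> freeman10 C p x w ->
  cmap (proj p) (a *: z + w) = a *: cmap (proj p) z + cmap (proj p) w.
Proof.
move=> p1 /(num10 p1)[z1 z2] /(num10 p1)[w1 w2].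
congr pair => /=.
  by rewrite projD ?projB ?projZ//; [exact: numZ..|apply: numB; exact: numZ].
by rewrite projD ?projD ?projZ//; [exact: numZ..|apply: numD; exact: numZ].
Qed.

Lemma cmap_proj_eq0 p (z : cplx (Tvec M)) : -1 <= p -> freeman10 C p x z ->
  cmap (proj p) z = 0 <-> freeman_nat C (level p).+1 x z.
Proof.
move=> p1 Fz; have [n1 n2] := num10 p1 Fz; have /freeRP[_ z2] := Fz.
split=> [[/(proj_eq0 n1)/(den_pos _ p1) d1 _]|/freeRP[d1 _]].
  exact/freeRP.
congr pair; apply/proj_eq0 => //; apply/den_pos => //.
by rewrite z2; apply: (distrN (freeR_subbundle C _)); exact: freeR_J.
Qed.

Lemma cmap_proj_eq p (z w : cplx (Tvec M)) : -1 <= p ->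
  freeman10 C p x z -> freeman10 C p x w ->
  cmap (proj p) z = cmap (proj p) w <-> freeman_nat C (level p).+1 x (z - w).
Proof.
move=> p1 Fz Fw; have Fzw := (freeman_nat_zmod C _ x).2 _ _ Fz Fw.
apply: iff_trans (cmap_proj_eq0 p1 Fzw); rewrite cmap_projB//.
by split=> [->|/eqP]; [rewrite subrr|rewrite subr_eq0 => /eqP].
Qed.

Lemma m10_proj p z : -1 <= p -> freeman10 C p x z ->
  m10 (m := core) (cmap (proj p) z).
Proof.
move=> p1 Fz; have [n1 n2] := num10 p1 Fz; have /freeRP[_ z2] := Fz.
rewrite /m10 /= /cmap; rewrite !coreJ_proj//.
have D1 := num_D p1 n1.
congr pair; rewrite /= scale0r scale1r.
  by rewrite sub0r z2 projN ?opprK//; exact: num_J.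
by rewrite add0r z2 crJN ?crJ_sqr ?opprK//; exact: crJ_crD.
Qed.

Lemma m10_rep p (z : cplx (core p)) : -1 <= p -> m10 z ->
  exists2 X, freeman_sec S p X & cmap (proj p) (ceval x X) = z.
Proof.
case: z => z1 z2 p1; rewrite /m10 /= /cmap /= => -[].
rewrite scale0r scale1r sub0r => e1 _.
have [v nv vz] := proj_onto z1.
have Fv : freeman10 C p x (v, - J x v) by exact/(num_pos _ p1).
have [X FX Xx] := freeman_extend Fv; exists X => //.
move: Xx; rewrite /ceval /cmap /= => -[-> ->]; rewrite projN; last exact: num_J.
by rewrite -coreJ_proj// vz e1 opprK.
Qed.

Lemma m01_rep (w : cplx (core (-1))) : m01 w ->
  exists2 Y, sD01 Y & cmap (proj (-1)) (ceval x Y) = w.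
Proof.
case: w => w1 w2; rewrite /m01 /= /cmap /= => -[].
rewrite oppr0 scale0r scaleN1r sub0r opprK => e1 _.
have [v nv vw] := proj_onto w1; have Dv := num_D (lexx _) nv.
have [X sX Xx] := distr_section bD Dv; exists (ahol S X); first exact: ahol_csections.
rewrite /ceval/cmap/= Xx vw; congr pair.
by rewrite /Jfield Xx -coreJ_proj// vw.
Qed.

(** The Levi form depends only on the classes of its arguments, by
    [levi_kernel_left] and [levi_kernel_right]. *)
Lemma coreL_proj p (X Y : cplx (field M)) (Z : cplx (Tvec M)) : 0 <= p ->
  freeman_sec S p X -> sD01 Y ->
  freeman10 C (p - 1) x Z -> D01 S x (ceval x (clie X Y) - Z) ->
  coreL (cmap (proj p) (ceval x X)) (cmap (proj (-1)) (ceval x Y)) =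
  cmap (proj (p - 1)) Z.
Proof.
move=> p0 FX DY FZ DZ; rewrite /coreL.
set Z' := pick_or _ _.
have [X' [Y' [FX' DY' FZ' DZ' [X'X Y'Y]]]] :
    levi_rel (cmap (proj p) (ceval x X)) (cmap (proj (-1)) (ceval x Y)) Z'.
  by apply: pick_orP; exists Z, X, Y; split.
have p1 : -1 <= p by lia.
have pm1 : -1 <= p - 1 by lia.
apply/cmap_proj_eq => //; rewrite -level_pred//.
have FdX : F (level p) (X' - X) by exact: (freeman_mod_zmod C _).2.
have DdY : sD01 (Y' - Y) by exact: (csections01_zmod S).2.
have vX := freeman_cvfield FX; have vX' := freeman_cvfield FX'.
have vY := csections_cvfield DY; have vY' := csections_cvfield DY'.
apply: (levi_fib_freeman (j := level (p - 1))).
- by rewrite (level_pred p0).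
- exact: (freeman_nat_zmod C _ x).2.
have -> : Z' - Z = ceval x (clie (X' - X) Y') + ceval x (clie X (Y' - Y)) -
    ((ceval x (clie X' Y') - Z') - (ceval x (clie X Y) - Z)).
  rewrite clieBl// clieBr// !cevalB.
  move: (ceval x (clie X' Y')) (ceval x (clie X Y')) (ceval x (clie X Y)) => a b c.
  by rewrite subrKA !opprB addrA subrKA addrC subrKA.
apply: (levi_fib_zmod C _ x).2.
  apply: (zmodsetD (levi_fib_zmod C _ x)).
    apply: levi_kernel_left => //; rewrite cevalB; apply/cmap_proj_eq => //.
      exact: freeman_modE.
    exact: freeman_modE.
  apply: levi_kernel_right => //.
  have [_ _ /(_ x)/D01P[Dd d2]] := DdY.
  apply/freeRP; split; last exact: (congr1 -%R d2).
  have nY W : sD01 W -> num (-1) (W.1 x).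
    by move=> /csections01P[sW _]; apply/num_pos => //; apply/freeR0; exact: sW.2.
  have : den (-1) (Y'.1 x - Y.1 x).
    apply/proj_eq0; first by apply: numB; exact: nY.
    rewrite projB; [|exact: nY..]; apply/eqP; rewrite subr_eq0; apply/eqP.
    exact: (congr1 (fun z : cplx (V (-1)) => z.1) Y'Y).
  by move/(den_pos _ (lexx _)).
apply: setsumr; first exact: freeman_nat_zmod.
exact: (D01_zmod S x).2.
Qed.

(** The form [L^(p+2)] at the level of sections. *)
Lemma coreL_section p (X Y : cplx (field M)) : 0 <= p ->
  freeman_sec S p X -> sD01 Y ->
  exists A, [/\ freeman_sec S (p - 1) A, sD01 (clie X Y - A) &
    coreL (cmap (proj p) (ceval x X)) (cmap (proj (-1)) (ceval x Y)) =
    cmap (proj (p - 1)) (ceval x A)].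
Proof.
move=> p0 FX DY.
have [A [B [FA DB XY]]] : levi_mod S (level (p - 1)) (clie X Y).
  have : F (level p) X by [].
  by rewrite level_pred// => -[_]; apply.
exists A; have BE : B = clie X Y - A by rewrite XY addrC addKr.
rewrite BE in DB; split=> //; apply: coreL_proj => //.
  exact: freeman_modE.
by have [_ _ /(_ x)] := DB.
Qed.

Lemma core_cgbr_proj p q r (X Y : cplx (field M)) : p < 0 -> q < 0 -> r = p + q ->
  tanaka_sec S p X.1 -> tanaka_sec S p X.2 ->
  tanaka_sec S q Y.1 -> tanaka_sec S q Y.2 ->
  cgbr (m := core) r (cmap (proj p) (ceval x X)) (cmap (proj q) (ceval x Y)) =
  cmap (proj r) (ceval x (clie X Y)).
Proof.
move=> p0 q0 rE TX1 TX2 TY1 TY2.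
rewrite /cgbr /cbil /= !core_br_proj//; congr pair => /=.
  by rewrite -projB; [|exact: (num_lie p0 q0 rE)..].
by rewrite -projD; [|exact: (num_lie p0 q0 rE)..].
Qed.

Local Notation m := core.

(** The two brackets can be exchanged modulo [F_(p-1)^10 + D^01] by [levi_swap],
    and [F_(p-1)^10] is divided out in degree [p - 2]. *)
Lemma coreL_swap p (z : cplx (m p)) (a b : cplx (m (-1))) : 1 <= p ->
  m10 z -> m01 a -> m01 b -> gL (gL z a) b = gL (gL z b) a.
Proof.
move=> p1 /m10_rep[|X FX <-]; first lia.
move=> /m01_rep[Y DY <-] /m01_rep[Y' DY' <-].
have p0 : 0 <= p by lia.
have pm0 : 0 <= p - 1 by lia.
have [A [FA DA /= ->]] := coreL_section p0 FX DY.
have [A' [FA' DA' /= ->]] := coreL_section p0 FX DY'.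
have [B [FB DB /= ->]] := coreL_section pm0 FA DY'.
have [B' [FB' DB' /= ->]] := coreL_section pm0 FA' DY.
have pm2 : -1 <= p - 1 - 1 by lia.
have vA := freeman_cvfield FA; have vA' := freeman_cvfield FA'.
apply/cmap_proj_eq; [done|exact: freeman_modE|exact: freeman_modE|].
rewrite -level_pred//.
apply: (levi_fib_freeman (j := level (p - 1 - 1))).
- by rewrite (level_pred pm0).
- by apply: (freeman_nat_zmod C _ x).2; exact: freeman_modE.
have sw : levi_mod S (level (p - 1)) (clie A Y' - clie A' Y).
  by apply: (levi_swap C _ FA FA' DY DY' DA DA'); rewrite -level_pred.
have -> : ceval x B - ceval x B' = ceval x (clie A Y' - clie A' Y) -
    ceval x ((clie A Y' - B) - (clie A' Y - B')).
  rewrite -!cevalB; congr (ceval x _).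
  move: (clie A Y') (clie A' Y) => u v.
  by rewrite !opprB addrA subrKA addrC subrKA.
apply: (levi_fib_zmod C _ x).2; first exact: levi_modE.
apply: setsumr; first exact: freeman_nat_zmod.
by have [_ _] := (csections01_zmod S).2 _ _ DB DB'; apply.
Qed.

(** The last step of the iterated form, where the second bracket is the one of
    the negative part and [D] is divided out. *)
Lemma coreL_swap0 p (z : cplx (m p)) (a b : cplx (m (-1))) : p = 0 ->
  m10 z -> m01 a -> m01 b -> cgbr (-2) (gL z a) b = cgbr (-2) (gL z b) a.
Proof.
move=> pE /m10_rep[|X FX <-]; first lia.
move=> /m01_rep[Y DY <-] /m01_rep[Y' DY' <-].
have p0 : 0 <= p by lia.
have [A [FA DA /= ->]] := coreL_section p0 FX DY.
have [A' [FA' DA' /= ->]] := coreL_section p0 FX DY'.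
have l0 : level (p - 1) = 0%N by rewrite pE.
have T10 (q : int) W : level q = 0%N -> Dcplx S W ->
    tanaka_sec S q W.1 /\ tanaka_sec S q W.2.
  by rewrite /tanaka_sec -/(level q) => ->.
have DFA : Dcplx S A by apply: csections10_Dcplx; exact: freeman_mod_D10 FA.
have DFA' : Dcplx S A' by apply: csections10_Dcplx; exact: freeman_mod_D10 FA'.
have [tA1 tA2] := T10 (p - 1) A l0 DFA; have [tA1' tA2'] := T10 (p - 1) A' l0 DFA'.
have [tY1 tY2] := T10 (-1) Y erefl (csections01_Dcplx DY).
have [tY1' tY2'] := T10 (-1) Y' erefl (csections01_Dcplx DY').
have pm0 : p - 1 < 0 by lia.
have pE2 : -2 = p - 1 + -1 by lia.
rewrite !(core_cgbr_proj pm0 _ pE2)//.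
have sw : levi_mod S 0 (clie A Y' - clie A' Y).
  rewrite -l0; apply: (levi_swap C _ FA FA' DY DY' DA DA').
  by rewrite -level_pred.
have [d1 d2] : Dcplx S (clie A Y' - clie A' Y).
  have [U [W [FU DW ->]]] := sw.
  have [u1 u2] := csections10_Dcplx FU; have [w1 w2] := csections01_Dcplx DW.
  by split; exact: (sectionsD bD).
have numc (U W : cplx (field M)) : tanaka_sec S (p - 1) U.1 -> tanaka_sec S (p - 1) U.2 ->
    tanaka_sec S (-1) W.1 -> tanaka_sec S (-1) W.2 ->
    num (-2) ((clie U W).1 x) /\ num (-2) ((clie U W).2 x).
  by move=> *; split; [apply: numB|apply: numD]; exact: (num_lie pm0 _ pE2).
have [n1 n2] := numc A Y' tA1 tA2 tY1' tY2'.
have [n1' n2'] := numc A' Y tA1' tA2' tY1 tY2.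
have den2 v : D x v -> den (-2) v.
  by move=> Dv; apply/den_neg => //; exact/tanaka_nat0.
congr pair; apply: proj_eq => //; apply: den2; [exact: d1.2|exact: d2.2].
Qed.

Lemma gL_iter_cons p (z : cplx (m p)) (w : cplx (m (-1)))
    (ws : seq (cplx (m (-1)))) : ws <> [::] ->
  gL_iter z (w :: ws) = gL_iter (gL z w) ws.
Proof. by case: ws. Qed.

Lemma m10_coreL p (z : cplx (m p)) (w : cplx (m (-1))) : 0 <= p ->
  m10 z -> m01 w -> m10 (gL z w).
Proof.
move=> p0 /m10_rep[|X FX <-]; first lia.
move=> /m01_rep[Y DY <-].
have [A [FA DA /= ->]] := coreL_section p0 FX DY.
by apply: m10_proj; [lia|exact: freeman_modE].
Qed.

Lemma gL_iter_swap (s1 : seq (cplx (m (-1)))) p (z : cplx (m p)) a b s2 :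
  0 <= p -> m10 z ->
  (forall w, w \in s1 ++ [:: a, b & s2] -> m01 w) ->
  size (s1 ++ [:: a, b & s2]) = (absz p).+2 ->
  gL_iter z (s1 ++ [:: a, b & s2]) = gL_iter z (s1 ++ [:: b, a & s2]).
Proof.
elim: s1 p z => [|c s1 IHs] p z p0 z10 ws01 szs.
  have a01 : m01 a by apply: ws01; rewrite !inE eqxx.
  have b01 : m01 b by apply: ws01; rewrite !inE eqxx orbT.
  rewrite !cat0s; case: s2 {ws01} szs => [|c s2] szs.
    by apply: coreL_swap0 => //; move: szs => /=; lia.
  rewrite (gL_iter_cons z)// (gL_iter_cons (gL z a))//.
  rewrite (gL_iter_cons z)// (gL_iter_cons (gL z b))//.
  by rewrite coreL_swap//; move: szs => /=; lia.
have c01 : m01 c by apply: ws01; rewrite mem_head.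
have ne (u v : cplx (m (-1))) : s1 ++ [:: u, v & s2] <> [::] by case: s1 {IHs ws01 szs}.
rewrite !cat_cons !(gL_iter_cons z)//.
have szs' : (size s1 + size s2).+3 = (absz p).+2.
  by rewrite -szs /= size_cat /= !addnS.
apply: IHs.
- lia.
- exact: m10_coreL.
- by move=> w ws; apply: ws01; rewrite in_cons ws orbT.
- rewrite size_cat /= !addnS.
  have pE : absz p = (absz (p - 1)).+1 by move: szs'; clear -p0; lia.
  by move: szs'; rewrite pE => -[->].
Qed.

Lemma core_br_grade p q r (u : m p) (v : m q) : r != p + q -> gbr r u v = 0.
Proof. by move=> /negbTE rn; rewrite /gbr /= /core_br rn. Qed.

Lemma core_br_antisymmetric p q r (u : m p) (v : m q) : p < 0 -> q < 0 ->
  gbr r u v = - gbr r v u.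
Proof.
move=> p0 q0; have [rE|rn] := eqVneq r (p + q); last first.
  by rewrite !core_br_grade ?oppr0//; rewrite addrC.
have [X [TX <-]] := sec_onto u p0; have [Y [TY <-]] := sec_onto v q0.
have rE' : r = q + p by rewrite addrC.
rewrite [LHS]core_br_proj// [X in - X]core_br_proj//.
by rewrite -projN; [congr proj; rewrite [lie X Y]lieC|exact: (num_lie q0 p0 rE' TY TX)].
Qed.

Lemma core_br_linear p q r (v : m q) : p < 0 -> q < 0 ->
  linear (fun u : m p => gbr r u v).
Proof.
move=> p0 q0 a u u'.
change (gbr r (a *: u + u') v = a *: gbr r u v + gbr r u' v).
have [rE|rn] := eqVneq r (p + q); last first.
  by rewrite !core_br_grade// scaler0 addr0.
have [X [TX <-]] := sec_onto u p0; have [X' [TX' <-]] := sec_onto u' p0.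
have [Y [TY <-]] := sec_onto v q0.
have TaX : tanaka_sec S p (a *: X + X').
  move: TX TX'; rewrite /tanaka_sec !(tanaka_sections C).
  exact: (sections_lin (tanaka_subbundle C _)).
have vX := tanaka_vfield C TX; have vX' := tanaka_vfield C TX'.
have vY := tanaka_vfield C TY.
rewrite -proj_lin; [|exact: num_sec..].
rewrite -[a *: X x + X' x]/((a *: X + X') x).
have E Z : tanaka_sec S p Z -> gbr (c := core) r (proj p (Z x)) (proj q (Y x)) =
    proj r (lie Z Y x) by move=> TZ; exact: core_br_proj.
rewrite (E _ TaX) (E _ TX) (E _ TX') lieDl ?lieZl//; last exact: vfieldZ.
by apply: proj_lin; [exact: (num_lie p0 q0 rE TX TY)|exact: (num_lie p0 q0 rE TX' TY)].
Qed.

Lemma core_jacobi p q r (u : m p) (v : m q) (w : m r) : p < 0 -> q < 0 -> r < 0 ->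
  gbr (p + q + r) u (gbr (q + r) v w)
  + gbr (p + q + r) v (gbr (r + p) w u)
  + gbr (p + q + r) w (gbr (p + q) u v) = 0.
Proof.
move=> p0 q0 r0.
have [X [TX <-]] := sec_onto u p0; have [Y [TY <-]] := sec_onto v q0.
have [Z [TZ <-]] := sec_onto w r0.
have Tlie i j A B : i < 0 -> j < 0 -> tanaka_sec S i A -> tanaka_sec S j B ->
    tanaka_sec S (i + j) (lie A B).
  by move=> i0 j0 TA TB; rewrite /tanaka_sec -/(level _) levelD//; exact: tanaka_bracket.
have br i j k l A B D : i < 0 -> j < 0 -> k < 0 -> l = i + (j + k) ->
    tanaka_sec S i A -> tanaka_sec S j B -> tanaka_sec S k D ->
    gbr l (proj i (A x) : m i) (gbr (j + k) (proj j (B x) : m j) (proj k (D x) : m k)) =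
    proj l (lie A (lie B D) x) /\ num l (lie A (lie B D) x).
  move=> i0 j0 k0 lE TA TB TD; have jk0 : j + k < 0 by lia.
  rewrite [X in gbr _ _ X]core_br_proj//; have TBD := Tlie _ _ _ _ j0 k0 TB TD.
  by rewrite [X in X = _ /\ _]core_br_proj//; split=> //; exact: num_lie TA TBD.
have l1 : p + q + r = p + (q + r) by lia.
have l2 : p + q + r = q + (r + p) by lia.
have l3 : p + q + r = r + (p + q) by lia.
have [-> n1] := br _ _ _ _ _ _ _ p0 q0 r0 l1 TX TY TZ.
have [-> n2] := br _ _ _ _ _ _ _ q0 r0 p0 l2 TY TZ TX.
have [-> n3] := br _ _ _ _ _ _ _ r0 p0 q0 l3 TZ TX TY.
have vX := tanaka_vfield C TX; have vY := tanaka_vfield C TY.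
have vZ := tanaka_vfield C TZ.
rewrite -!projD//; last exact: numD.
rewrite -[RHS](proj0 (p + q + r)); congr proj.
rewrite (lie_jacobi vX vY vZ) [lie Z (lie X Y)]lieC.
rewrite [lie Z X]lieC lieNr//; last exact: lie_vfield.
rewrite -[(lie (lie X Y) Z + lie Y (lie X Z)) x]/(lie (lie X Y) Z x + lie Y (lie X Z) x).
rewrite -[(- lie Y (lie X Z)) x]/(- lie Y (lie X Z) x).
rewrite -[(- lie (lie X Y) Z) x]/(- lie (lie X Y) Z x).
move: (lie (lie X Y) Z x) (lie Y (lie X Z) x) => a b.
by rewrite addrK subrr.
Qed.

(** By involutivity, [[X, Y] - [JX, JY]] is a section of [D], which is divided
    out in degree [-2]. *)
Lemma core_J_invariant (v w : m (-1)) : gbr (-2) (gJ v) (gJ w) = gbr (-2) v w.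
Proof.
have neg1 : (-1 : int) < 0 by []. have m11 : (-1 : int) <= -1 by [].
have [X [sX <-]] := sec_onto v neg1; have [Y [sY <-]] := sec_onto w neg1.
have nX := num_sec neg1 sX; have nY := num_sec neg1 sY.
have JX : @gJ R core (-1) (proj (-1) (X x)) = proj (-1) (Jfield S X x).
  exact: coreJ_proj.
have JY : @gJ R core (-1) (proj (-1) (Y x)) = proj (-1) (Jfield S Y x).
  exact: coreJ_proj.
rewrite JX JY.
have sJX := Jfield_sections sX; have sJY := Jfield_sections sY.
rewrite [LHS](core_br_proj (X := Jfield S X) (Y := Jfield S Y))//.
rewrite [RHS]core_br_proj//.
have nl A B : tanaka_sec S (-1) A -> tanaka_sec S (-1) B -> num (-2) (lie A B x).
  exact: num_lie.
apply/esym/proj_eq; [exact: nl|exact: nl|].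
apply/den_neg => //; apply/tanaka_nat0.
have [[_ s1] _] := lie_Jfield sX sY; exact: (s1 x).
Qed.

Lemma proj_sum p (N : nat) (G : 'I_N -> Tvec M) : (forall i, num p (G i)) ->
  num p (\sum_i G i) /\ proj p (\sum_i G i) = \sum_i proj p (G i).
Proof.
move=> nG; elim: (index_enum _) => [|i s [ns ps]].
  by rewrite !big_nil; split; [exact: num0|exact: proj0].
by rewrite !big_cons projD// ps; split=> //; exact: numD.
Qed.

(** In degree [p <= -2] the recursion of the Tanaka sequence writes a section as
    a sum of brackets and of a section of [D_(p+1)], which is divided out. *)
Lemma core_generated (A : forall p, {vspace m p}) :
  (forall v : m (-1), v \in A (-1)) ->
  (forall p q (u : m p) (v : m q), p < 0 -> q < 0 ->
     u \in A p -> v \in A q -> gbr (p + q) u v \in A (p + q)) ->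
  forall p (v : m p), p < 0 -> v \in A p.
Proof.
move=> A1 Abr.
have Abr' p q r (u : m p) (v : m q) : p < 0 -> q < 0 -> r = p + q ->
    u \in A p -> v \in A q -> gbr r u v \in A r.
  by move=> p0 q0 ->; exact: Abr.
suff gen l p X : p < 0 -> level p = l -> tanaka_sec S p X ->
    (proj p (X x) : m p) \in A p.
  by move=> p v p0; have [X [TX <-]] := sec_onto v p0; exact: gen TX.
elim: l p X => [|l IHl] p X p0 lp TX.
  have pE : p = -1 by move: lp; rewrite /level; lia.
  by subst p; exact: A1.
have p2 : p <= -2 by move: lp; rewrite /level; lia.
have q0 : p + 1 < 0 by lia.
have lq : level (p + 1) = l by move: lp; rewrite level_neg// => -[].
move: (TX); rewrite /tanaka_sec -/(level p) lp.
move=> /tanaka_modSP[B [N [U [W [TB sU TW XE]]]]].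
have TB' : tanaka_sec S (p + 1) B by rewrite /tanaka_sec -/(level _) lq.
have TW' i : tanaka_sec S (p + 1) (W i) by rewrite /tanaka_sec -/(level _) lq.
have pE : p = -1 + (p + 1) by lia.
have nUW i : num p (lie (U i) (W i) x).
  by apply: (num_lie _ q0 pE (sU i) (TW' i)).
have XxE : X x = \sum_(i < N) lie (U i) (W i) x + B x.
  by rewrite XE addrC -[LHS]/((\sum_(i < N) lie (U i) (W i)) x + B x) fct_sumE.
have dB : den p (B x) by apply/den_neg => //; rewrite lp /=; exact: tanaka_modE.
have nX : num p (X x) by exact: num_sec.
have [nS pS] := proj_sum nUW.
have -> : proj p (X x) = \sum_(i < N) proj p (lie (U i) (W i) x).
  rewrite -pS; apply: proj_eq => //.
  by rewrite XxE [X in den _ (X - _)]addrC addrK.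
apply: rpred_sum => i _; rewrite -(core_br_proj _ q0 pE (sU i) (TW' i))//.
by apply: Abr' => //; exact: IHl.
Qed.

Lemma core_nondeg (v : m (-1)) :
  (forall w : m (-1), gbr (-2) v w = 0) -> v = 0.
Proof.
have neg1 : (-1 : int) < 0 by [].
have [X [sX <-]] := sec_onto v neg1 => br0.
apply/proj_eq0; first exact: num_sec.
apply/den_pos => //; apply: levi_nondegenerate => // Y sY.
have nXY : num (-2) (lie X Y x) by exact: (num_lie neg1 neg1 erefl sX sY).
have := br0 (proj (-1) (Y x)); rewrite [LHS]core_br_proj//.
by move=> /(proj_eq0 nXY)/den_neg-/(_ erefl)/tanaka_nat0.
Qed.

Lemma coreJ_linear p : -1 <= p -> linear (@gJ _ m p).
Proof.
move=> p1 a u u'; have [v nv <-] := proj_onto u; have [v' nv' <-] := proj_onto u'.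
have E w : num p w -> @gJ R core p (proj p w) = proj p (J x w) by exact: coreJ_proj.
rewrite -proj_lin// !E//; last exact: num_lin.
rewrite crJ_linear; [|exact: num_D nv|exact: num_D nv'].
by apply: proj_lin; exact: num_J.
Qed.

Lemma coreJ_sqr p (u : m p) : -1 <= p -> gJ (gJ u) = - u.
Proof.
move=> p1; have [v nv <-] := proj_onto u.
have E w : num p w -> @gJ R core p (proj p w) = proj p (J x w) by exact: coreJ_proj.
rewrite !E//; last exact: num_J.
by rewrite crJ_sqr ?projN//; exact: num_D nv.
Qed.

Lemma coreL_linearl p (a : R[i]) (z z' : cplx (m p)) (w : cplx (m (-1))) : 0 <= p ->
  m10 z -> m10 z' -> m01 w -> gL (a *: z + z') w = a *: gL z w + gL z' w.
Proof.
move=> p0; have p1 : -1 <= p by lia.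
have pm1 : -1 <= p - 1 by lia.
move=> /(m10_rep p1)[X FX <-] /(m10_rep p1)[X' FX' <-] /m01_rep[Y DY <-].
have [A [FA DA /= ->]] := coreL_section p0 FX DY.
have [A' [FA' DA' /= ->]] := coreL_section p0 FX' DY.
rewrite -!cmap_proj_lin//; try exact: freeman_modE.
apply: (coreL_proj (X := a *: X + X')) => //.
- exact: freeman_mod_lin.
- by apply: freeman_nat_lin; exact: freeman_modE.
have vX := freeman_cvfield FX; have vX' := freeman_cvfield FX'.
have vY := csections_cvfield DY.
have [_ _ /(_ x)] := csections01_lin a DA DA'.
rewrite clieDl//; last exact: cvfieldZ.
rewrite clieZl// scalerBr addrACA -opprD cevalB; apply.
Qed.

Lemma coreL_linearr p (a : R[i]) (z : cplx (m p)) (w w' : cplx (m (-1))) : 0 <= p ->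
  m10 z -> m01 w -> m01 w' -> gL z (a *: w + w') = a *: gL z w + gL z w'.
Proof.
move=> p0; have p1 : -1 <= p by lia.
have pm1 : -1 <= p - 1 by lia.
move=> /(m10_rep p1)[X FX <-] /m01_rep[Y DY <-] /m01_rep[Y' DY' <-].
have [A [FA DA /= ->]] := coreL_section p0 FX DY.
have [A' [FA' DA' /= ->]] := coreL_section p0 FX DY'.
have nY W : sD01 W -> num (-1) (W.1 x) /\ num (-1) (W.2 x).
  by move=> /csections01_Dcplx[[_ d1] [_ d2]]; split; apply/num_pos => //; exact/freeR0.
have [n1 n2] := nY _ DY; have [n1' n2'] := nY _ DY'.
have -> : a *: cmap (proj (-1)) (ceval x Y) + cmap (proj (-1)) (ceval x Y') =
    cmap (proj (-1)) (ceval x (a *: Y + Y')).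
  congr pair; rewrite /=.
    rewrite -[RHS]/(proj (-1) (complex.Re a *: Y.1 x - complex.Im a *: Y.2 x + Y'.1 x)).
    by rewrite projD ?projB ?projZ//; [exact: numZ..|apply: numB; exact: numZ].
  rewrite -[RHS]/(proj (-1) (complex.Re a *: Y.2 x + complex.Im a *: Y.1 x + Y'.2 x)).
  by rewrite projD ?projD ?projZ//; [exact: numZ..|apply: numD; exact: numZ].
rewrite -!cmap_proj_lin//; try exact: freeman_modE.
apply: (coreL_proj (Y := a *: Y + Y')) => //.
- exact: csections01_lin.
- by apply: freeman_nat_lin; exact: freeman_modE.
have vX := freeman_cvfield FX; have vY' := csections_cvfield DY'.
have vY := csections_cvfield DY.
have [_ _ /(_ x)] := csections01_lin a DA DA'.
rewrite clieDr//; last exact: cvfieldZ.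
rewrite clieZr// scalerBr addrACA -opprD cevalB; apply.
Qed.

Lemma coreL_symmetric p (z : cplx (m p)) (ws ws' : seq (cplx (m (-1)))) : 0 <= p ->
  m10 z -> (forall w, w \in ws -> m01 w) -> size ws = (absz p).+2 ->
  perm_eq ws ws' -> gL_iter z ws = gL_iter z ws'.
Proof.
move=> p0 z10 ws01 szw; apply: perm_eq_neighbours => s1 a b s2 pws.
apply: gL_iter_swap => // [w|]; first by rewrite -(perm_mem pws); exact: ws01.
by rewrite -(perm_size pws).
Qed.

Lemma m01_proj (z : cplx (Tvec M)) : D01 S x z ->
  m01 (m := core) (cmap (proj (-1)) z).
Proof.
move=> /D01P[D1 z2].
have nD v : D x v -> num (-1) v by move=> Dv; apply/num_pos => //; exact/freeR0.
have JD1 := crJ_crD D1; have n2 : num (-1) z.2 by rewrite z2; exact: nD.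
rewrite /m01 /= /cmap !coreJ_proj//; last exact: nD.
congr pair; rewrite /= oppr0 scale0r scaleN1r.
  by rewrite sub0r opprK z2.
by rewrite add0r z2 crJ_sqr// projN//; exact: nD.
Qed.

(** If the Levi forms of [X] and [X'] have the same classes at [x], then
    [X - X'] lies at [x] in the kernel, that is in [F_(p+1)^10]. *)
Lemma coreL_injective p (z z' : cplx (m p)) : 0 <= p -> m10 z -> m10 z' ->
  (forall w, m01 w -> gL z w = gL z' w) -> z = z'.
Proof.
move=> p0; have p1 : -1 <= p by lia.
have pm1 : -1 <= p - 1 by lia.
move=> /(m10_rep p1)[X FX <-] /(m10_rep p1)[X' FX' <-] Lzz'.
apply/cmap_proj_eq; [done|exact: freeman_modE..|].
have FdX : F (level p) (X - X') by exact: (freeman_mod_zmod C _).2.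
rewrite -cevalB; apply: freeman_kernel => // Y DY.
have vX := freeman_cvfield FX; have vX' := freeman_cvfield FX'.
have vY := csections_cvfield DY.
have [_ _ /(_ x) DYx] := DY; have := Lzz' _ (m01_proj DYx).
have [A [FA DA /= ->]] := coreL_section p0 FX DY.
have [A' [FA' DA' /= ->]] := coreL_section p0 FX' DY.
move=> /cmap_proj_eq-/(_ pm1 (freeman_modE C x FA) (freeman_modE C x FA')).
rewrite -level_pred// => FAA'; rewrite clieBl//.
have -> : ceval x (clie X Y - clie X' Y) = (ceval x A - ceval x A') +
    ceval x ((clie X Y - A) - (clie X' Y - A')).
  rewrite -cevalB -cevalD; congr (ceval x _).
  move: (clie X Y) (clie X' Y) => u v.
  by rewrite opprB addrCA !subrKA.
exists (ceval x A - ceval x A'), (ceval x ((clie X Y - A) - (clie X' Y - A'))).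
split=> //; have [_ _] := (csections01_zmod S).2 _ _ DA DA'; exact.
Qed.

Lemma core_is_core :
  (exists N : nat, forall p, (N < absz p)%N -> forall v : m p, v = 0) -> is_core m.
Proof.
move=> fin; split=> //.
- exact: coreJ_linear.
- by move=> p p1 v; exact: coreJ_sqr.
- by move=> p q r p0 q0 v; exact: core_br_linear.
- move=> p q r p0 q0 u a v v'.
  change (gbr r u (a *: v + v') = a *: gbr r u v + gbr r u v').
  rewrite !(core_br_antisymmetric r u _ p0 q0) scalerN -opprD; congr (- _).
  exact: core_br_linear.
- by move=> p q r _ _ rn u v; exact: core_br_grade.
- by move=> p q r p0 q0 u v; exact: core_br_antisymmetric.
- by move=> p q r p0 q0 r0 u v w; exact: core_jacobi.
- exact: core_J_invariant.
- exact: core_generated.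
- exact: core_nondeg.
- by move=> p p0 z w; exact: m10_coreL.
- by move=> p p0 a z z' w; exact: coreL_linearl.
- by move=> p p0 a z w w'; exact: coreL_linearr.
- by move=> p p0 z ws ws'; exact: coreL_symmetric.
- by move=> p p0 z z'; exact: coreL_injective.
Qed.

Lemma core_natural : natural_core C x (m := m) proj.
Proof.
split=> [p p1 v nv|p q X Y p0 q0 TX TY|p X Y Z p0 FX DY FZ DZ].
- exact: coreJ_proj.
- exact: core_br_proj.
- exact: coreL_proj.
Qed.

End NaturalCore.

(** * Existence of the core *)

Section DegreewiseQuotients.
Context (R : realType) (n : nat) (M : manifold R n) (S : CR_structure M).
Variables (C : regular_CR S) (x : M).
Implicit Types (p : int) (v : Tvec M).

Lemma freeR_le i j v : (i <= j)%N -> freeR C j x v -> freeR C i x v.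
Proof.
by move=> /subnK <-; elim: (j - i)%N => [//|k IHk] /freeR_mono.
Qed.

Lemma den_num p v : mx_den C x p v -> mx_num C x p v.
Proof.
have [p0|p0] := ltP p 0.
  move=> /(den_neg C x v p0) dv; apply/num_neg => //; move: dv.
  case: (level p) => [/freeR_D Dv|l]; first exact/tanaka_nat0.
  exact: tanaka_nat_mono.
have p1 : -1 <= p by lia.
by move=> /(den_pos C x v p1)/freeR_mono nv; exact/num_pos.
Qed.

Lemma num_basis p : exists (r : nat) (e : 'I_r -> Tvec M), is_basis (mx_num C x p) e.
Proof.
have [p0|p0] := ltP p 0.
  have -> : mx_num C x p = tanaka_nat C (level p) x.
    by apply/seteqP; split=> v /(num_neg C x v p0).
  exact: subbundle_basis (tanaka_subbundle C _).
have p1 : -1 <= p by lia.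
have -> : mx_num C x p = freeR C (level p) x.
  by apply/seteqP; split=> v /(num_pos C x v p1).
exact: subbundle_basis (freeR_subbundle C _).
Qed.

Lemma den_basis p : exists (r : nat) (e : 'I_r -> Tvec M), is_basis (mx_den C x p) e.
Proof.
have [p1|p1] := leP (-1) p.
  have -> : mx_den C x p = freeR C (level p).+1 x.
    by apply/seteqP; split=> v /(den_pos C x v p1).
  exact: subbundle_basis (freeR_subbundle C _).
have p2 : p <= -2 by lia.
rewrite /mx_den p2; exact: subbundle_basis (tanaka_subbundle C _).
Qed.

Lemma degree_quotient p : exists (d : nat) (proj : Tvec M -> 'rV[R]_d),
  is_quotient (mx_num C x p) (mx_den C x p) proj.
Proof.
have [rA [eA bA]] := num_basis p; have [rB [eB bB]] := den_basis p.
by apply: quotient_exists bA bB _ => v; exact: den_num.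
Qed.

End DegreewiseQuotients.

Theorem lemma2p3 (R : realType) (n : nat) (M : manifold R n)
    (S : CR_structure M) (C : regular_CR S) (mu k : nat)
    (mu_gt0 : (0 < mu)%N)
    (D_mu : forall x : M, tanakaD C (- mu%:Z) x = tangent x)
    (k_nondeg : nondegenerate_CR C k) (x : M) :
  exists (m : core_data R) (proj : forall p : int, Tvec M -> m p),
    [/\ forall p : int, is_quotient (mx_num C x p) (mx_den C x p) (proj p),
        is_core m,
        natural_core C x proj,
        has_depth m mu &
        has_height m (k%:Z - 2)].
Proof.
pose dq p := cid (degree_quotient C x p).
pose V p : vectType R := 'rV[R]_(projT1 (dq p)).
pose proj p : Tvec M -> V p := projT1 (cid (projT2 (dq p))).
have projP p : is_quotient (mx_num C x p) (mx_den C x p) (proj p).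
  exact: projT2 (cid (projT2 (dq p))).
have zero p : (forall v, mx_num C x p v -> mx_den C x p v) -> forall u : V p, u = 0.
  move=> nd u; have [_ /(_ u)[v nv <-] projK] := projP p.
  by apply/projK => //; exact: nd.
(* [D_p] is the whole tangent bundle for all [p <= -mu]. *)
have depth : has_depth (core C x proj) mu.
  move=> p pmu; apply: zero => v nv; have p2 : p <= -2 by lia.
  have p0 : p < 0 by lia.
  rewrite /mx_den p2; apply: (tanaka_nat_mono (i := level (- mu%:Z))).
    by rewrite /level; lia.
  rewrite -/(tanakaD C _ x) D_mu; move: nv => /(num_neg C x v p0).
  exact: (distr_tangent (tanaka_subbundle C _)).
have height : has_height (core C x proj) (k%:Z - 2).
  move=> p pk; apply: zero => v nv; have p1 : -1 <= p by lia.
  have kp : k%:Z - 1 <= p by lia.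
  have Fv : freeR C (level (k%:Z - 1)) x v.
    apply: freeR_le ((num_pos C x v p1).1 nv); rewrite /level; lia.
  have [_ ndk] := k_nondeg.
  have v0 : (v, 0) = 0 :> cplx (Tvec M) by apply: (ndk x); exact/reFP.
  have -> : v = 0 := congr1 (fun z : cplx (Tvec M) => z.1) v0.
  apply/den_pos => //; exact: (distr0 (freeR_subbundle C _)).
exists (core C x proj), proj; split=> //.
  apply: core_is_core => //; exists (mu + k + 2)%N => p pN v.
  have [pmu|pmu] := ltP p (- mu%:Z); first exact: depth.
  by apply: height; lia.
exact: core_natural.
Qed.
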